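(* There is a constant $\kappa_0\in[0.55,0.56]$ such that for every $\kappa\in\,]\tfrac12,1[$ with $\kappa\le\kappa_0$ the Sinai-Bowen-Ruelle measure $\mu$ is absolutely continuous with respect to Lebesgue measure on $[0,1]\times\mathbb{R}$, and its density is square integrable.
   Context: Let $\gamma\in\,]\tfrac12,1[$ and $\kappa=\frac{1}{2\gamma}\in\,]\tfrac12,1[$. For $\xi\in[0,1]$ let $(\bar\xi_{-n})_{n\ge0}\in\{0,1\}^{\mathbb{N}}$ be its dyadic digits, $\xi=\sum_{n\ge0}\bar\xi_{-n}2^{-(n+1)}$; for a dyadic rational $\xi\neq0$ the expansion that is not eventually $0$ is chosen. For $k\ge0$ and $x\in[0,1]$, the second component of the $k$-th iterate of the baker's transformation is $$B_2^k(\xi,x)=\frac{\bar\xi_{-k+1}}{2}+\frac{\bar\xi_{-k+2}}{2^2}+\cdots+\frac{\bar\xi_0}{2^k}+\frac{x}{2^k}.$$ Define $S(\xi,x)=2\pi\sum_{n=1}^\infty\kappa^n\sin\big(2\pi B_2^n(\xi,x)\big)$. The Sinai-Bowen-Ruelle measure is the push-forward $\mu$ of two-dimensional Lebesgue measure $\lambda^2$ on $[0,1]^2$ under $(\xi,x)\mapsto(x,S(\xi,x))$, a Borel measure on $[0,1]\times\mathbb{R}$. *)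

(* Defs.v *)
From HB Require Import structures.
From mathcomp Require Import all_boot all_order all_algebra.
From mathcomp Require Import all_classical all_reals all_analysis measurable_realfun.
From mathcomp Require Import lra ring zify.

Set Implicit Arguments.
Unset Strict Implicit.
Unset Printing Implicit Defensive.

Import Order.TTheory GRing.Theory Num.Theory numFieldNormedType.Exports.

Local Open Scope classical_set_scope.
Local Open Scope ring_scope.

Section dyadic_digits.
Context {R : realType}.
Implicit Types (xi : R) (d : nat -> bool).

Definition dyadic_rational xi := exists k m : nat, xi = k%:R / 2 ^+ m.

Definition eventually_zero d := exists m, forall n, (m <= n)%N -> d n = false.

(* [d n] stands for the digit of index -n *)
Definition dyadic_expansion xi d :=
  series (fun n => (d n)%:R / 2 ^+ n.+1) @ \oo --> xi /\
  (dyadic_rational xi -> xi != 0 -> ~ eventually_zero d).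

(* the default value is used only outside [0, 1], see dyadic_digitsP *)
Definition dyadic_digits xi : nat -> bool :=
  xget (fun=> false) [set d | dyadic_expansion xi d].

Definition baker2 (k : nat) (xi x : R) : R :=
  \sum_(1 <= i < k.+1) (dyadic_digits xi (k - i)%N)%:R / 2 ^+ i + x / 2 ^+ k.

Definition SBR_height (kappa xi x : R) : R :=
  2 * pi * limn (fun N : nat =>
    \sum_(1 <= n < N.+1) kappa ^+ n * sin (2 * pi * baker2 n xi x)).

Fixpoint dyadic_num d (n : nat) : nat :=
  if n is m.+1 then (dyadic_num d m).*2 + d m else 0.

Let pow2_gt0 n : 0 < 2 ^+ n :> R. Proof. by rewrite exprn_gt0. Qed.
Let pow2_neq0 n : 2 ^+ n != 0 :> R. Proof. by rewrite gt_eqF. Qed.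

Lemma dyadic_series_num d n :
  series (fun n => (d n)%:R / 2 ^+ n.+1) n = (dyadic_num d n)%:R / 2 ^+ n :> R.
Proof.
elim: n => [|n IH]; first by rewrite seriesEnat/= big_geq// mul0r.
rewrite seriesEnat/= big_nat_recr//=.
move: IH; rewrite seriesEnat/= => ->.
have := pow2_neq0 n; rewrite exprS natrD -muln2 natrM => ?.
by field.
Qed.

Let num_lt_ub d xi : 0 < xi ->
  (series (fun n => (d n)%:R / 2 ^+ n.+1) : R^nat) @ \oo --> xi -> ~ eventually_zero d ->
  forall n, (dyadic_num d n)%:R < 2 ^+ n * xi <= (dyadic_num d n).+1%:R.
Proof.
move=> xi0 + nz n; rewrite (_ : series _ = fun n => (dyadic_num d n)%:R / 2 ^+ n); last first.
  by apply/funext => k; rewrite dyadic_series_num.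
set u := (fun n => _) => cu.
have uS k : u k.+1 = u k + (d k)%:R / 2 ^+ k.+1.
  rewrite /u -!dyadic_series_num !seriesEnat/= big_nat_recr//=.
have ule k : u k <= xi.
  rewrite -(cvg_lim _ cu)//; apply: nondecreasing_cvgn_le; last exact: cvgP cu.
  by apply/nondecreasing_seqP => j; rewrite uS lerDl divr_ge0// ltW.
have lev k : xi <= u k + 1 / 2 ^+ k.
  pose v := (fun k => u k + 1 / 2 ^+ k).
  have cv : v @ \oo --> xi.
    rewrite -[X in _ --> X]addr0; apply: cvgD => //.
    under eq_fun do rewrite div1r -exprVn.
    by apply: cvg_expr; rewrite ger0_norm; lra.
  rewrite -(cvg_lim _ cv)//; apply: nonincreasing_cvgn_ge; last exact: cvgP cv.
  apply/nonincreasing_seqP => j; rewrite /v uS -addrA lerD2l.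
  rewrite [1 / 2 ^+ j](_ : _ = (1 + 1) / 2 ^+ j.+1).
    by rewrite mulrDl lerD2r ler_pM2r ?invr_gt0//; case: (d j); rewrite ?ler01.
  by have := pow2_neq0 j; rewrite exprS => ?; field.
have [m nm dm] : exists2 m, (n <= m)%N & d m.
  apply: contrapT => H; apply: nz; exists n => m nm.
  by apply/negP => dm; apply: H; exists m.
have unm : u n <= u m.
  have H : {homo u : x y / (x <= y)%N >-> x <= y}.
    by apply/nondecreasing_seqP => j; rewrite uS lerDl divr_ge0// ltW.
  exact: H.
have um : u m < xi.
  by apply: lt_le_trans (ule m.+1); rewrite uS dm ltrDl divr_gt0.
apply/andP; split.
  by rewrite mulrC -ltr_pdivrMr//; exact: le_lt_trans um.
rewrite mulrC -ler_pdivlMr// -natr1 mulrDl; exact: lev.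
Qed.

Let expansion_num d xi : 0 < xi -> dyadic_expansion xi d ->
  forall n, (dyadic_num d n)%:R < 2 ^+ n * xi <= (dyadic_num d n).+1%:R.
Proof.
move=> xi0 [cd nz]; apply: num_lt_ub => // -[m dm].
apply: nz; rewrite ?gt_eqF//; last by exists m.
exists (dyadic_num d m), m.
rewrite -dyadic_series_num; apply: (cvg_unique _ cd).
  exact: norm_hausdorff.
apply: cvg_near_cst; exists m => // k /= mk.
rewrite !seriesEnat/= (big_cat_nat (n := m))//= [X in _ + X]big_nat_cond.
rewrite [X in _ + X]big1 ?addr0//.
by move=> i /andP[/andP[mi _] _]; rewrite dm// mul0r.
Qed.

Let num_expansion d xi : 0 < xi ->
  (forall n, (dyadic_num d n)%:R < 2 ^+ n * xi <= (dyadic_num d n).+1%:R) ->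
  dyadic_expansion xi d.
Proof.
move=> xi0 H; split; last first.
  move=> _ _ [m dm].
  have numE k : dyadic_num d (k + m) = (2 ^ k * dyadic_num d m)%N.
    elim: k => [|k IH]; first by rewrite mul1n.
    by rewrite addSn /= dm ?leq_addl// IH addn0 expnS -muln2; lia.
  have /andP[Hm _] := H m.
  have [k Hk] : exists k, 1 < 2 ^+ k * (2 ^+ m * xi - (dyadic_num d m)%:R).
    set e := _ - _; have e0 : 0 < e by rewrite subr_gt0.
    exists (Num.truncn e^-1).+1.
    rewrite -ltr_pdivrMr// div1r.
    apply: lt_le_trans (truncnS_gt _) _.
    by rewrite -natrX ler_nat ltnW// ltn_expl.
  have /andP[_] := H (k + m)%N; rewrite numE -[X in _ <= X]natr1 natrM natrX exprD.
  move: Hk; rewrite mulrBr mulrA => Hk Hk'.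
  lra.
rewrite (_ : series _ = fun n => (dyadic_num d n)%:R / 2 ^+ n); last first.
  by apply/funext => k; rewrite dyadic_series_num.
apply: (@squeeze_cvgr _ _ _ _ (fun n => xi - 1 / 2 ^+ n) (cst xi)); last exact: cvg_cst.
  apply: nearW => n; have /andP[h1 h2] := H n.
  rewrite ler_pdivlMr// mulrBl divfK// ler_pdivrMr// (mulrC xi) (ltW h1) andbT.
  by rewrite lerBlDr [X in _ <= X]natr1.
rewrite -[X in _ --> X]subr0; apply: cvgB; first exact: cvg_cst.
under eq_fun do rewrite div1r -exprVn.
by apply: cvg_expr; rewrite ger0_norm; lra.
Qed.
Lemma dyadic_expansion_ge0 d xi : dyadic_expansion xi d -> 0 <= xi.
Proof.
move=> [cd _]; rewrite -(cvg_lim _ cd)//; apply: limr_ge; first exact: cvgP cd.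
by apply: nearW => n; rewrite dyadic_series_num divr_ge0// ltW.
Qed.

Lemma dyadic_expansion_le1 d xi : dyadic_expansion xi d -> xi <= 1.
Proof.
move=> ed; have := dyadic_expansion_ge0 ed; rewrite le0r => /orP[/eqP ->//|xi0].
by have /andP[_] := expansion_num xi0 ed 0; rewrite expr0 mul1r.
Qed.

Let expansion0 d : dyadic_expansion 0 d -> d = fun=> false.
Proof.
move=> [cd _]; apply/funext => n; apply/negbTE/negP => dn.
set u := series _ in cd.
have uS k : u k.+1 = u k + (d k)%:R / 2 ^+ k.+1.
  by rewrite /u !seriesEnat/= big_nat_recr.
have : u n.+1 <= 0.
  rewrite -(cvg_lim _ cd)//; apply: nondecreasing_cvgn_le; last exact: cvgP cd.
  by apply/nondecreasing_seqP => j; rewrite uS lerDl divr_ge0// ltW.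
apply/negP; rewrite -ltNge uS dn /u dyadic_series_num.
by rewrite ltr_wpDl ?divr_gt0 ?divr_ge0// ltW.
Qed.

Let bracket_uniq (y : R) (a b : nat) :
  a%:R < y <= a.+1%:R -> b%:R < y <= b.+1%:R -> a = b.
Proof.
move=> /andP[a1 a2] /andP[b1 b2].
have : a%:R < b.+1%:R :> R by exact: lt_le_trans b2.
have : b%:R < a.+1%:R :> R by exact: lt_le_trans a2.
by rewrite !ltr_nat; lia.
Qed.

Lemma dyadic_expansion_unique xi d d' :
  dyadic_expansion xi d -> dyadic_expansion xi d' -> d = d'.
Proof.
move=> ed ed'; have := dyadic_expansion_ge0 ed; rewrite le0r => /orP[/eqP xi0|xi0].
  by rewrite xi0 in ed ed'; rewrite (expansion0 ed) (expansion0 ed').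
have E n : dyadic_num d n = dyadic_num d' n.
  exact: bracket_uniq (expansion_num xi0 ed n) (expansion_num xi0 ed' n).
apply/funext => n; have := E n.+1; rewrite /= E.
by case: (d n) (d' n) => -[]//; lia.
Qed.

Let greedy xi := fix g (n : nat) : nat := if n is m.+1 then
   ((g m).*2 + ((g m).*2.+1%:R < 2 ^+ m.+1 * xi)%R)%N else 0%N.

Lemma dyadic_expansion_exists xi : 0 <= xi <= 1 ->
  exists d, dyadic_expansion xi d.
Proof.
rewrite le0r => /andP[/orP[/eqP ->|xi0] xi1].
  exists (fun=> false); split; last by rewrite eqxx.
  apply: cvg_near_cst; apply: nearW => n.
  by rewrite seriesEnat/= big1// => i _; rewrite mul0r.
pose d n := ((greedy xi n).*2.+1%:R < 2 ^+ n.+1 * xi)%R.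
exists d; apply: num_expansion => // n.
have -> : dyadic_num d n = greedy xi n by elim: n => //= n ->.
elim: n => [|n /andP[h1 h2]]; first by rewrite expr0 mul1r xi0.
move: h1 h2; rewrite /=; set g := greedy xi n.
rewrite exprS -mulrA; set y := 2 ^+ n * xi => h1 h2.
have S1 (m : nat) : m.+1%:R = m%:R + 1 :> R by rewrite natr1.
have D2 : g.*2%:R = 2 * g%:R :> R by rewrite -mul2n natrM.
have D2S : g.*2.+1%:R = 2 * g%:R + 1 :> R by rewrite S1 D2.
rewrite (S1 g) in h2; rewrite (S1 (_ + _)%N) natrD D2 D2S.
by case: (ltP (2 * g%:R + 1) (2 * y)) => h /=; apply/andP; split; lra.
Qed.

Lemma dyadic_digitsP xi : 0 <= xi <= 1 ->
  dyadic_expansion xi (dyadic_digits xi).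
Proof. by move=> /dyadic_expansion_exists; exact: xgetPex. Qed.

Lemma dyadic_digitsE xi n : dyadic_digits xi n <->
  0 < xi <= 1 /\
  exists k : nat, k.*2.+1%:R / 2 ^+ n.+1 < xi <= k.*2.+2%:R / 2 ^+ n.+1.
Proof.
have bE (k : nat) : k.*2.+1%:R / 2 ^+ n.+1 < xi <= k.*2.+2%:R / 2 ^+ n.+1 <->
    k.*2.+1%:R < 2 ^+ n.+1 * xi <= k.*2.+2%:R.
  by rewrite ltr_pdivrMr// ler_pdivlMr// (mulrC xi).
split.
  move=> dn.
  have ed : dyadic_expansion xi (dyadic_digits xi).
    by move: dn; rewrite /dyadic_digits; case: xgetP.
  have : 0 <= xi by exact: dyadic_expansion_ge0 ed.
  rewrite le0r => /orP[/eqP xi0|xi0].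
    by move: ed dn; rewrite xi0 => /expansion0 ->.
  rewrite xi0 (dyadic_expansion_le1 ed); split => //.
  exists (dyadic_num (dyadic_digits xi) n); apply/bE.
  by have := expansion_num xi0 ed n.+1; rewrite /= dn addn1.
move=> [/andP[xi0 xi1] [k /bE kP]].
have ed : dyadic_expansion xi (dyadic_digits xi).
  by apply: dyadic_digitsP; rewrite ltW.
have := bracket_uniq (expansion_num xi0 ed n.+1) kP.
by rewrite /=; case: (dyadic_digits xi n) => //; lia.
Qed.

Lemma measurable_dyadic_digits n :
  measurable_fun setT (fun xi : R => (dyadic_digits xi n)%:R : R).
Proof.
have -> : (fun xi => (dyadic_digits xi n)%:R) =
    \1_[set xi | dyadic_digits xi n] :> (R -> R).
  apply/funext => xi; rewrite indicE; congr (_%:R).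
  by congr (nat_of_bool _); apply/idP/idP; rewrite inE.
apply: measurable_indic.
have -> : [set xi : R | dyadic_digits xi n] = `]0, 1]%classic `&` \bigcup_k
    `]k.*2.+1%:R / 2 ^+ n.+1, k.*2.+2%:R / 2 ^+ n.+1]%classic.
  apply/seteqP; split => xi /=.
    move=> /dyadic_digitsE[h [k hk]]; split; first by rewrite /= in_itv.
    by exists k => //=; rewrite in_itv.
  move=> [+ [k _]]; rewrite /= !in_itv/= => h hk; apply/dyadic_digitsE.
  by split => //; exists k.
apply: measurableI; first exact: measurable_itv.
by apply: bigcup_measurable => k _; exact: measurable_itv.
Qed.

Lemma measurable_baker2 k :
  measurable_fun setT (fun z : R * R => baker2 k z.1 z.2).
Proof.
apply: measurable_funD.
  apply: measurable_sum => i; apply: measurable_funM => //.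
  exact: (measurableT_comp (measurable_dyadic_digits _) measurable_fst).
by apply: measurable_funM => //; exact: measurable_snd.
Qed.

Lemma is_cvg_SBR_height kappa xi x : `|kappa| < 1 ->
  cvgn (fun N : nat =>
    \sum_(1 <= n < N.+1) kappa ^+ n * sin (2 * pi * baker2 n xi x)).
Proof.
move=> k1.
pose w n := kappa ^+ n.+1 * sin (2 * pi * baker2 n.+1 xi x).
rewrite (_ : (fun N => _) = series w); last first.
  by apply/funext => N; rewrite seriesEnat/= big_add1.
apply: normed_cvg; apply: (@series_le_cvg _ _ (geometric 1 `|kappa|)).
- by move=> n; exact: normr_ge0.
- by move=> n; rewrite /= mul1r exprn_ge0.
- move=> n /=; rewrite /w normrM normrX mul1r.
  rewrite -[leRHS]mulr1 ler_pM//.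
    by rewrite exprS ler_piMl ?exprn_ge0// ltW.
  by rewrite ler_norml sin_geN1 sin_le1.
- by apply: is_cvg_geometric_series; rewrite normr_id.
Qed.

Lemma measurable_SBR_height kappa : `|kappa| < 1 ->
  measurable_fun setT (fun z : R * R => SBR_height kappa z.1 z.2).
Proof.
move=> k1; apply: measurable_funM => //.
apply: (@measurable_fun_cvg _ _ _ _ (fun N z =>
    \sum_(1 <= n < N.+1) kappa ^+ n * sin (2 * pi * baker2 n z.1 z.2))).
  move=> N; apply: measurable_sum => n; apply: measurable_funM => //.
  apply: measurableT_comp; first exact: (continuous_measurable_fun (@continuous_sin _)).
  by apply: measurable_funM => //; exact: measurable_baker2.
by move=> z _; exact: is_cvg_SBR_height.
Qed.

End dyadic_digits.

Section measures.
Context (R : realType).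
Local Notation plane := (measurableTypeR R * measurableTypeR R)%type.

Local Notation lebesgue2 := (@lebesgue_measure R \x @lebesgue_measure R)%E.

Definition unit_square : set plane := `[0, 1] `*` `[0, 1].
Definition strip : set plane := `[0, 1] `*` setT.

Lemma measurable_unit_square : measurable unit_square.
Proof. by apply: measurableX; exact: measurable_itv. Qed.

Lemma measurable_strip : measurable strip.
Proof. by apply: measurableX; [exact: measurable_itv|exact: measurableT]. Qed.

(* Lebesgue measure on [0,1]^2 and on [0,1] x R, carried by the plane *)
Definition lebesgue_square : set plane -> \bar R :=
  mrestr lebesgue2 measurable_unit_square.
HB.instance Definition _ := Measure.on lebesgue_square.

Definition lebesgue_strip : set plane -> \bar R :=
  mrestr lebesgue2 measurable_strip.
HB.instance Definition _ := Measure.on lebesgue_strip.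

Definition SBR_map (kappa : R) (z : plane) : plane := (z.2, SBR_height kappa z.1 z.2).

Lemma measurable_SBR_map kappa : `|kappa| < 1 ->
  measurable_fun setT (SBR_map kappa).
Proof.
move=> k1; apply: measurable_fun_pair; first exact: measurable_snd.
exact: measurable_SBR_height.
Qed.

Definition SBR_measure (kappa : R) : set plane -> \bar R :=
  pushforward lebesgue_square (SBR_map kappa).

Definition is_density (mu nu : set plane -> \bar R) (f : plane -> R) :=
  [/\ measurable_fun setT f, forall z, 0 <= f z &
      forall A, measurable A -> mu A = (\int[nu]_(z in A) (f z)%:E)%E].

End measures.
Arguments lebesgue_square : clear implicits.
Arguments lebesgue_strip : clear implicits.

(* Main.v *)
Require Import Defs.
From HB Require Import structures.
From mathcomp Require Import all_boot all_order all_algebra.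
From mathcomp Require Import all_classical all_reals all_analysis.
From mathcomp Require Import lra ring zify measurable_realfun.

(** Let mu_x be the law of S(xi, x) for xi uniform, so that mu is the integral
    of the mu_x over x in [0, 1].  The density of mu is square integrable as soon
    as the energy E(r), the probability that |S(xi, x) - S(eta, x)| <= r for
    independent uniform xi, eta and x, is O(r).

    Split E(r) according to the first digits of xi and eta.  If they agree, the
    self-similarity S((xi + b) / 2, x) = kappa (2 pi sin(pi (x + b)) +
    S(xi, (x + b) / 2)) turns the contribution into E(r / kappa) / 2.  If they
    differ, x |-> S(xi, x) - S(eta, x) is transversal to 0: writing it as
    2 pi kappa (2 sin(pi x) + ...), where |cos(pi x)| >= 61/200 the derivative of
    the leading term dominates, and elsewhere sin(pi x) >= 119/125 and the
    difference itself is bounded away from 0.  Hence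
    E(r) <= E(r / kappa) / 2 + c r, and iterating gives E(r) = O(r) since
    2 kappa > 1.

    The densities f_n of mu averaged over dyadic intervals of length 2^-n of the
    second coordinate form a martingale with ||f_n||^2 <= 2^n E(2^-n), bounded in
    n.  It is therefore Cauchy in L^2, and its limit is the density of mu. *)

Set Implicit Arguments.
Unset Strict Implicit.
Unset Printing Implicit Defensive.

Import Order.TTheory GRing.Theory Num.Theory numFieldNormedType.Exports.

Local Open Scope classical_set_scope.
Local Open Scope ring_scope.

(** * Transversality of the height functions *)

Section trig_bounds.
Context {R : realType}.
Implicit Types (t kappa : R) (b c : bool).

Lemma sinDpi_bool t b : sin (t + pi * b%:R) = (-1) ^+ b * sin t.
Proof.
by case: b; rewrite ?mulr1 ?mulr0 ?addr0 ?sinDpi ?expr1 ?mulN1r ?expr0 ?mul1r.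
Qed.

Lemma sin_double t : sin (2 * t) = 2 * sin t * cos t.
Proof. by rewrite mulr_natl sin_mulr2n; ring. Qed.

Lemma cos_double t : cos (2 * t) = 1 - 2 * sin t ^+ 2.
Proof. by rewrite mulr_natl cos_mulr2n cos2sin2; lra. Qed.

(** Bounding each sine by 1 would only give 1.8525 at [kappa = 55 / 100]; the saving comes from the
    angles being successive doubles of [t], so that with [S] and [C] on the unit circle the problem
    becomes algebraic. *)
Lemma sin_block_le kappa t : 0 <= kappa <= 55 / 100 ->
  sin (4 * t) + kappa * sin (2 * t) + kappa ^+ 2 * sin t <= 769 / 500.
Proof.
move=> k01; rewrite (_ : 4 * t = 2 * (2 * t)); last by lra.
rewrite sin_double; have := cos2Dsin2 (2 * t); have := cos_double t.
set S := sin (2 * t); set C := cos (2 * t); set s := sin t => hC hSC.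
(* AM-GM [sin t <= (sin t ^+ 2 / a + a) / 2] with [a = 43/100], near the
   maximiser, leaves a quadratic form in [S] and [C] on the unit circle *)
pose u : R := (1 - C) / (4 * (43 / 100)) + 43 / 200.
have su : s <= u.
  rewrite /u hC; have := sqr_ge0 (s - 43 / 100); rewrite expr2 => ?; rewrite expr2; lra.
have SC1 : 2 * S * C <= 1 by have := sqr_ge0 (S - C); rewrite !expr2 in hSC *; lra.
have cert : 2 * S * C + 55 / 100 * (S + 55 / 100 * u) <= 769 / 500.
  (* [h1] is the AM-GM splitting of [2 * S * (C + 275 / 1000)]. With [S ^+ 2 = 1 - C ^+ 2], a
     concave quadratic in [C] remains, whose maximiser is close to [617 / 1000], the centre of
     [h2]. *)
  rewrite /u; have h1 := sqr_ge0 (1133 / 1000 * S - (C + 275 / 1000)).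
  have h2 := sqr_ge0 (C - 617 / 1000).
  have := cos_le1 (2 * t); have := cos_geN1 (2 * t); rewrite -/C => h3 h4.
  rewrite !expr2 in hSC h1 h2; lra.
have u0 : 0 <= u by have := cos_le1 (2 * t); rewrite /u -/C; lra.
have /andP[k0 k1] := k01.
have h1 : kappa ^+ 2 * s <= kappa * (55 / 100 * u).
  rewrite expr2 -mulrA ler_wpM2l//; apply: le_trans (_ : kappa * u <= _).
    by rewrite ler_wpM2l.
  by rewrite ler_wpM2r.
(* If the bracket is nonnegative, [kappa] can be raised to [55 / 100] and [cert] applies; otherwise
   the bracket contributes at most 0 and [SC1] suffices. *)
have [Su0|/ltW Su0] := leP 0 (S + 55 / 100 * u).
  by have := ler_wpM2r Su0 k1; rewrite mulrDr; lra.
by have := mulr_ge0_le0 k0 Su0; rewrite mulrDr; lra.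
Qed.

Lemma norm_sin_block_le kappa t : 0 <= kappa <= 55 / 100 ->
  `|sin (4 * t) + kappa * sin (2 * t) + kappa ^+ 2 * sin t| <= 769 / 500.
Proof.
move=> k01; rewrite ler_norml sin_block_le// andbT.
by have := sin_block_le (- t) k01; rewrite !mulrN !sinN !mulrN; lra.
Qed.

(** The sharp bound is the square root of 2, of which [283 / 200] is a rational majorant. *)
Lemma norm_signed_sin_cos_le t b c :
  `|(-1) ^+ b * sin t + (-1) ^+ c * cos t| <= 283 / 200.
Proof.
have h0 := cos2Dsin2 t; have h1 := sqr_ge0 (sin t + cos t).
have h2 := sqr_ge0 (sin t - cos t).
have le_sqr (x : R) : x ^+ 2 <= 2 -> `|x| <= 283 / 200.
  rewrite expr2 => x2; rewrite ler_norml; apply/andP.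
  by split; rewrite leNgt; apply/negP => h; nra.
apply: le_sqr.
by case: b; case: c; rewrite ?expr1 ?expr0 ?mulN1r ?mul1r; lra.
Qed.

Lemma sin_lipschitz (x y : R) : `|sin x - sin y| <= `|x - y|.
Proof.
wlog xy : x y / x < y => [wlg|].
  by have [/wlg//|/wlg h|->] := ltgtP x y; rewrite ?subrr// distrC (distrC x).
have [|z _ /= h] := @MVT _ sin cos x y xy (fun z _ => is_derive_sin z).
  by apply: continuous_subspaceT => z; exact: continuous_sin.
by rewrite distrC (distrC x) h normrM ler_piMl// cos_max.
Qed.

End trig_bounds.

(** * Backward orbits of the doubling map and truncated height functions *)

Section preorbits.
Context {R : realType}.
Implicit Types (d : nat -> bool) (x y z kappa : R).

(** A backward orbit of [x] under doubling modulo 1, where the digit [d n] selects the inverse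
    branch at time [n]. This recursive form of [baker2] (see [baker2E]) makes sense for arbitrary
    digit sequences. *)
Fixpoint preorbit d x n : R := if n is m.+1 then (preorbit d x m + (d m)%:R) / 2 else x.

Arguments preorbit : simpl never.

Lemma preorbitS d x n : preorbit d x n.+1 = (preorbit d x n + (d n)%:R) / 2.
Proof. by []. Qed.

Lemma preorbit_shift d x n :
  preorbit d x n.+1 = preorbit (fun k => d k.+1) ((x + (d 0%N)%:R) / 2) n.
Proof. by elim: n => // n IH; rewrite preorbitS IH. Qed.

Lemma preorbitB d x y n : preorbit d x n - preorbit d y n = (x - y) / 2 ^+ n.
Proof.
elim: n => [|n IH]; first by rewrite expr0 divr1.
by rewrite !preorbitS -mulrBl opprD addrACA subrr addr0 IH exprS invfM mulrA mulrAC.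
Qed.

Lemma sin_preorbitS d x n :
  sin (2 * pi * preorbit d x n) = sin (2 * (2 * pi * preorbit d x n.+1)).
Proof.
(* The two angles differ by [2 * pi] times a digit; written as two shifts by [pi], their signs
   cancel. *)
rewrite preorbitS [in RHS](_ : 2 * _ = 2 * pi * preorbit d x n + pi * (d n)%:R + pi * (d n)%:R).
  by rewrite !sinDpi_bool signrMK.
by lra.
Qed.

Lemma sin_preorbitSS d x n :
  sin (2 * pi * preorbit d x n) = sin (4 * (2 * pi * preorbit d x n.+2)).
Proof.
rewrite sin_preorbitS [preorbit d x n.+2]preorbitS; set t := preorbit d x n.+1.
rewrite [in RHS](_ : 4 * _ = 2 * (2 * pi * t) + pi * (d n.+1)%:R +
  pi * (d n.+1)%:R + pi * (d n.+1)%:R + pi * (d n.+1)%:R).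
  by rewrite !sinDpi_bool !signrMK.
by lra.
Qed.

Definition height_sum kappa d x N :=
  \sum_(1 <= n < N.+1) kappa ^+ n * sin (2 * pi * preorbit d x n).

Lemma height_sumS kappa d x N : height_sum kappa d x N.+1 =
  height_sum kappa d x N + kappa ^+ N.+1 * sin (2 * pi * preorbit d x N.+1).
Proof. by rewrite /height_sum big_nat_recr. Qed.

Definition block kappa t : R :=
  sin (4 * t) + kappa * sin (2 * t) + kappa ^+ 2 * sin t.

(* Consecutive angles are related by doubling, so the terms grouped by three are
   all functions of one angle, and they cannot be extremal simultaneously: the
   crude bound [kappa ^+ 3 / (1 - kappa)] on the tail would not suffice below *)
Lemma height_sum_blocks kappa d x m :
  height_sum kappa d x (3 * m).+2 = height_sum kappa d x 2 +
  \sum_(j < m) kappa ^+ (3 * j).+3 * block kappa (2 * pi * preorbit d x (3 * j).+4.+1).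
Proof.
elim: m => [|m IH]; first by rewrite big_ord0 addr0 muln0.
rewrite (_ : (3 * m.+1).+2 = (3 * m).+2.+3)%N; last by lia.
rewrite 3!height_sumS IH big_ord_recr /= -!addrA.
congr (_ + (_ + _)); rewrite /block.
rewrite (sin_preorbitSS _ _ (3 * m).+3) (sin_preorbitS _ _ (3 * m).+4).
rewrite [kappa ^+ (3 * m).+4]exprS [kappa ^+ (3 * m).+4.+1]exprS [kappa ^+ (3 * m).+4]exprS.
by rewrite expr2; ring.
Qed.

Lemma height_sum2 kappa d x : height_sum kappa d x 2 =
  kappa * ((-1) ^+ d 0%N * sin (pi * x)) +
  kappa ^+ 2 * ((-1) ^+ d 1%N * sin (pi / 2 * (x + (d 0%N)%:R))).
Proof.
rewrite height_sumS height_sumS /height_sum big_geq// add0r expr1.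
rewrite (_ : 2 * pi * preorbit d x 1 = pi * x + pi * (d 0%N)%:R); last first.
  by rewrite preorbitS (_ : preorbit d x 0 = x)//; lra.
rewrite (_ : 2 * pi * preorbit d x 2 = pi / 2 * (x + (d 0%N)%:R) + pi * (d 1%N)%:R).
  by rewrite !sinDpi_bool.
by rewrite preorbitS preorbitS (_ : preorbit d x 0 = x)//; lra.
Qed.

Lemma sum_geometric_le (q : R) m : 0 <= q -> (\sum_(j < m) q ^+ j) * (1 - q) <= 1.
Proof.
by move=> q0; rewrite mulrC -opprB mulNr -subrX1 opprB lerBlDr lerDl exprn_ge0.
Qed.

(** The blocks form a geometric series of ratio [kappa ^+ 3], and [363 / 1000] lies just above the
    value of [kappa ^+ 2 / (1 - kappa ^+ 3)] at [55 / 100]. One factor [kappa] is kept so that the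
    bound can be compared with the leading term. *)
Lemma sum_block_le kappa d x m : 0 <= kappa <= 55 / 100 ->
  `|\sum_(j < m) kappa ^+ (3 * j).+3 * block kappa (2 * pi * preorbit d x (3 * j).+4.+1)|
  <= 363 / 1000 * (769 / 500) * kappa.
Proof.
move=> k01; have /andP[k0 k1] := k01.
apply: le_trans (ler_norm_sum _ _ _) _.
apply: le_trans (_ : \sum_(j < m) (kappa ^+ 3) ^+ j * (kappa ^+ 3 * (769 / 500)) <= _).
  apply: ler_sum => j _; rewrite normrM ger0_norm ?exprn_ge0// -!exprM -[(3 * j).+3]addn3.
  rewrite exprD -[leLHS]mulrA; apply: ler_wpM2l; first exact: exprn_ge0.
  by apply: ler_wpM2l; [exact: exprn_ge0|exact: norm_sin_block_le].
rewrite -mulr_suml.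
have := @sum_geometric_le (kappa ^+ 3) m (exprn_ge0 _ k0).
set G := \sum_(j < m) _.
have G0 : 0 <= G by apply: sumr_ge0 => j _; rewrite !exprn_ge0.
have k2 : kappa ^+ 2 <= 121 / 400 by rewrite expr2; nra.
have k3 : kappa ^+ 3 <= 121 / 400 * kappa by rewrite exprSr ler_wpM2r.
have k30 : 0 <= kappa ^+ 3 by rewrite exprn_ge0.
move: k3 k30; set c := kappa ^+ 3 => k3 k30 Gc.
have c1 : c <= 167 / 1000 by lra.
have G12 : G <= 12 / 10 + 1 / 2000 by nra.
have : G * c <= 363 / 1000 * kappa; last by lra.
nra.
Qed.

End preorbits.
Arguments preorbit {R} d x n : simpl never.

(** * Transversality for two digit sequences with different first digits *)

Section transversality.
Context {R : realType}.
Variables (kappa : R) (d d' : nat -> bool).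
Hypotheses (k01 : 0 <= kappa <= 55 / 100) (d0 : d 0%N = false) (d'0 : d' 0%N = true).
Implicit Types (x y z : R) (b : bool).

Definition height_diff x N := height_sum kappa d x N - height_sum kappa d' x N.

(** The first two terms of the difference. Shifting by the first digit of [d'] turns one sine into a
    cosine, and the minus sign in front of it is absorbed by negating the digit. *)
Let leading x := 2 * kappa * sin (pi * x) + kappa ^+ 2 *
  ((-1) ^+ d 1%N * sin (pi / 2 * x) + (-1) ^+ (~~ d' 1%N) * cos (pi / 2 * x)).

Let height_diff2 x : height_diff x 2 = leading x.
Proof.
rewrite /height_diff !height_sum2 d0 d'0 expr1 addr0 mul1r mulrDr mulr1 sinDpihalf.
by rewrite /leading signrN; ring.
Qed.

(** In units of [kappa], the main term is at least 2 * 0.952 = 1.904, the second-order term at most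
    0.55 * 1.415 = 0.77825, and the two tails together at most 2 * 0.363 * 1.538, about 1.1166. The
    margin exceeds 1/200. *)
Lemma height_diff_ge x m : 119 / 125 <= sin (pi * x) ->
  kappa / 200 <= height_diff x (3 * m).+2.
Proof.
have /andP[k0 k1] := k01.
move=> hs; have -> : height_diff x (3 * m).+2 = height_diff x 2 +
    (\sum_(j < m) kappa ^+ (3 * j).+3 * block kappa (2 * pi * preorbit d x (3 * j).+4.+1) -
     \sum_(j < m) kappa ^+ (3 * j).+3 * block kappa (2 * pi * preorbit d' x (3 * j).+4.+1)).
  by rewrite /height_diff !height_sum_blocks; ring.
have := sum_block_le d x m k01; rewrite ler_norml => /andP[h1 _].
have := sum_block_le d' x m k01; rewrite ler_norml => /andP[_ h2].
have := norm_signed_sin_cos_le (pi / 2 * x) (d 1%N) (~~ d' 1%N).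
rewrite ler_norml height_diff2 /leading => /andP[h3 _].
have h4 : kappa * (119 / 125) <= kappa * sin (pi * x) by exact: ler_wpM2l.
move: h3; set c : R := _ + _ => h3.
have h5 : - (55 / 100 * (283 / 200) * kappa) <= kappa ^+ 2 * c.
  have := ler_wpM2l (sqr_ge0 kappa) h3; have := ler_wpM2l k0 k1.
  by rewrite expr2; lra.
lra.
Qed.

Let leading' z := pi * kappa * (2 * cos (pi * z) + kappa / 2 *
  ((-1) ^+ d 1%N * cos (pi / 2 * z) + (-1) ^+ d' 1%N * sin (pi / 2 * z))).

Let is_derive_leading z : is_derive z 1 leading (leading' z).
Proof.
apply: is_derive_eq.
by rewrite /GRing.scale /= signrN /leading'; ring.
Qed.

(** The term of index [n] has Lipschitz constant [2 * pi * (kappa / 2) ^+ n], since [preorbit]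
    contracts by [2 ^+ n]. The extra factor 1/2 makes a termwise estimate strong enough, without
    blocks. *)
Lemma preorbit_tail_lipschitz (e : nat -> bool) x y M : y <= x ->
  `|\sum_(n < M) kappa ^+ n.+3 * sin (2 * pi * preorbit e x n.+3) -
    \sum_(n < M) kappa ^+ n.+3 * sin (2 * pi * preorbit e y n.+3)|
  <= 21 / 200 * pi * kappa * (x - y).
Proof.
have /andP[k0 k1] := k01.
move=> yx; rewrite -sumrB; apply: le_trans (ler_norm_sum _ _ _) _.
pose q := kappa / 2; have q0 : 0 <= q by rewrite /q; lra.
apply: le_trans (_ : \sum_(n < M) q ^+ n * (q ^+ 3 * (2 * pi * (x - y))) <= _).
  apply: ler_sum => n _; rewrite -mulrBr normrM ger0_norm ?exprn_ge0//.
  apply: le_trans (ler_wpM2l (exprn_ge0 _ k0) (sin_lipschitz _ _)) _.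
  rewrite -mulrBr preorbitB normrM ger0_norm ?mulr_ge0 ?pi_ge0//.
  rewrite ger0_norm ?divr_ge0 ?subr_ge0 ?exprn_ge0//.
  rewrite [leRHS]mulrA -exprD addn3 /q expr_div_n.
  by rewrite le_eqVlt; apply/orP; left; apply/eqP; move: (kappa ^+ n.+3) ((2 ^+ n.+3)^-1) => K E; ring.
rewrite -mulr_suml.
have := @sum_geometric_le _ q M q0; set G := \sum_(n < M) _ => Gq.
have G0 : 0 <= G by apply: sumr_ge0 => j _; rewrite exprn_ge0.
have pxy : 0 <= pi * (x - y) :> R by rewrite mulr_ge0 ?pi_ge0 ?subr_ge0.
have hG : G * q ^+ 3 <= 21 / 400 * kappa.
  have q1 : q <= 11 / 40 by rewrite /q; lra.
  have q2 : q ^+ 2 <= 121 / 1600.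
    by have := ler_wpM2l q0 q1; rewrite expr2; lra.
  have q3 : q ^+ 3 <= 121 / 1600 * q by rewrite exprSr ler_wpM2r.
  have G14 : G <= 138 / 100 by have := ler_wpM2l G0 q1; lra.
  have := ler_wpM2l G0 q3; have := ler_wpM2r q0 G14.
  have -> : kappa = 2 * q by rewrite /q; lra.
  lra.
have := ler_wpM2r pxy hG; lra.
Qed.

(** In units of [pi * kappa], the derivative of the leading part is at least 2 * 0.305 - 0.275 *
    1.415 = 0.220875 in absolute value, while the two tails cost 2 * 0.105 = 0.21; the margin
    exceeds 1/100. The bit [b] records the sign of the cosine. *)
Lemma height_diff_slope b x y M : y <= x ->
  (forall z, y <= z <= x -> 61 / 200 <= (-1) ^+ b * cos (pi * z)) ->
  pi * kappa / 100 * (x - y) <=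
    (-1) ^+ b * (height_diff x M.+2 - height_diff y M.+2).
Proof.
have /andP[k0 k1] := k01.
move=> yx hz.
have hsE e t : height_sum kappa e t M.+2 = height_sum kappa e t 2 +
    \sum_(n < M) kappa ^+ n.+3 * sin (2 * pi * preorbit e t n.+3).
  elim: M => [|M IH]; first by rewrite big_ord0 addr0.
  by rewrite height_sumS IH big_ord_recr /= addrA.
have hdE t : height_diff t M.+2 = leading t +
    (\sum_(n < M) kappa ^+ n.+3 * sin (2 * pi * preorbit d t n.+3) -
     \sum_(n < M) kappa ^+ n.+3 * sin (2 * pi * preorbit d' t n.+3)).
  by rewrite -height_diff2 /height_diff !hsE; ring.
rewrite !hdE.
have /ler_normlP[] := preorbit_tail_lipschitz d M yx.
have /ler_normlP[] := preorbit_tail_lipschitz d' M yx.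
set A := \sum_(n < M) _; set B := \sum_(n < M) _.
set C := \sum_(n < M) _; set D := \sum_(n < M) _ => h1 h2 h3 h4.
have cont : {within `[y, x], continuous leading}.
  by apply: derivable_within_continuous => z _; exact: ex_derive.
(* Only the leading part is differentiated; the tails enter through their Lipschitz bounds. *)
have [z zxy lz] := MVT_segment yx (fun z _ => is_derive_leading z) cont.
have pk : 0 <= pi * kappa * (x - y) by rewrite !mulr_ge0 ?pi_ge0 ?subr_ge0.
have cz := hz z zxy.
have := norm_signed_sin_cos_le (pi / 2 * z) (d' 1%N) (d 1%N).
rewrite addrC => /ler_normlP[]; set c : R := (-1) ^+ d 1%N * _ + _ => c1 c2.
have hl : (61 / 100 - 55 / 200 * (283 / 200)) * (pi * kappa * (x - y)) <=
    (-1) ^+ b * (leading x - leading y).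
  rewrite lz /leading' -/c.
  have kc1 : kappa * c <= 55 / 100 * (283 / 200) by have := ler_wpM2l k0 c2; lra.
  have kc2 : - (kappa * c) <= 55 / 100 * (283 / 200) by have := ler_wpM2l k0 c1; lra.
  rewrite (_ : (-1) ^+ b * _ = (2 * ((-1) ^+ b * cos (pi * z)) +
    (-1) ^+ b * (kappa * c) / 2) * (pi * kappa * (x - y))); last by ring.
  apply: ler_wpM2r => //.
  by move: cz; case: (b); rewrite ?expr1 ?expr0 ?mulN1r ?mul1r; lra.
by move: hl; case: (b); rewrite ?expr1 ?expr0 ?mulN1r ?mul1r; lra.
Qed.

End transversality.

(** * Self-similarity of the height function, and passage to the limit *)

Section SBR_height_digits.
Context {R : realType}.
Implicit Types (xi eta x y kappa : R) (b : bool).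

Lemma baker2E n xi x : baker2 n xi x = preorbit (dyadic_digits xi) x n.
Proof.
elim: n => [|n IH]; first by rewrite /baker2 big_geq// add0r expr0 divr1.
rewrite preorbitS -IH /baker2 big_ltn// big_add1 /= subn1 expr1.
rewrite mulrDl mulrDl mulr_suml exprS invfM mulrA [in RHS]mulrAC -!addrA [RHS]addrA [RHS]addrC.
congr (_ + _); rewrite [x / 2 / _]mulrAC; congr (_ + _); apply: eq_big_nat => i _.
by rewrite subSS exprS invfM mulrA mulrAC.
Qed.

Definition cons_digit b (d : nat -> bool) n := if n is m.+1 then d m else b.

Lemma series_cons_digit b (d : nat -> bool) n :
  series (fun n => (cons_digit b d n)%:R / 2 ^+ n.+1) n.+1 =
  (series (fun n => (d n)%:R / 2 ^+ n.+1) n + b%:R) / 2 :> R.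
Proof.
rewrite !seriesEnat /= big_nat_recl// expr1 addrC mulrDl mulr_suml; congr (_ + _).
by apply: eq_bigr => i _; rewrite [2 ^+ i.+2]exprS invfM mulrA mulrAC.
Qed.

(** By uniqueness of the expansion, it is enough that the prefixed sequence is admissible: if
    [(xi + b%:R) / 2] is dyadic then so is [xi], and as [xi] is nonzero its digits are not
    eventually 0. *)
Lemma dyadic_digits_half b xi : 0 < xi <= 1 ->
  dyadic_digits ((xi + b%:R) / 2) = cons_digit b (dyadic_digits xi).
Proof.
move=> /andP[xi0 xi1]; apply: dyadic_expansion_unique.
  apply: dyadic_digitsP; have : 0 <= (b%:R : R) <= 1 by case: b; rewrite ?lexx ?ler01.
  lra.
have [cd nz] : dyadic_expansion xi (dyadic_digits xi).
  by apply: dyadic_digitsP; rewrite xi1 ltW.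
split.
  rewrite -cvg_shiftS /=.
  under eq_fun do rewrite series_cons_digit.
  by apply: cvgMl; apply: cvgD => //; exact: cvg_cst.
move=> [k [m hk]] _ [N hN]; apply: nz.
- have h : xi = 2 * (k%:R / 2 ^+ m) - b%:R by rewrite -hk; lra.
  have p0 : (0 < 2 ^+ m :> R) by rewrite exprn_gt0.
  (* Positivity of [xi] ensures that the subtraction of natural numbers giving its numerator below
     is not truncated. *)
  have kb : (b * 2 ^ m <= 2 * k)%N.
    rewrite -(ler_nat R) !natrM natrX -ler_pdivlMr// -mulrA.
    by have := ltW xi0; rewrite h subr_ge0.
  exists (2 * k - b * 2 ^ m)%N, m.
  rewrite natrB// !natrM natrX mulrBl mulfK ?gt_eqF//.
  by rewrite h mulrA.
- by rewrite gt_eqF.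
- by exists N => n Nn; exact: (hN n.+1 (leqW Nn)).
Qed.

Lemma height_sum_cons kappa b (d : nat -> bool) x N :
  height_sum kappa (cons_digit b d) x N.+1 =
  kappa * (sin (pi * (x + b%:R)) + height_sum kappa d ((x + b%:R) / 2) N).
Proof.
rewrite /height_sum big_ltn// big_add1 /= [kappa * (_ + _)]mulrDr mulr_sumr expr1; congr (_ * sin _ + _).
  by rewrite preorbitS (_ : preorbit _ x 0 = x)//=; lra.
apply: eq_big_nat => n _; rewrite exprS -mulrA; congr (_ * (_ * sin (_ * _))).
exact: preorbit_shift.
Qed.

Lemma cvg_height_sum kappa xi x : `|kappa| < 1 ->
  (fun N => 2 * pi * height_sum kappa (dyadic_digits xi) x N) @ \oo --> SBR_height kappa xi x.
Proof.
move=> k1; rewrite /SBR_height; apply: cvgMr.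
have := is_cvg_SBR_height (kappa := kappa) (xi := xi) (x := x) k1.
rewrite (_ : (fun N : nat => _) = height_sum kappa (dyadic_digits xi) x)//.
by apply/funext => N; apply: eq_bigr => n _; rewrite baker2E.
Qed.

Lemma SBR_height_half kappa b xi x : `|kappa| < 1 -> 0 < xi <= 1 ->
  SBR_height kappa ((xi + b%:R) / 2) x =
  kappa * (2 * pi * sin (pi * (x + b%:R)) + SBR_height kappa xi ((x + b%:R) / 2)).
Proof.
move=> k1 xi01.
have := @cvg_height_sum kappa ((xi + b%:R) / 2) x k1.
rewrite dyadic_digits_half// -cvg_shiftS /=.
under eq_fun do rewrite height_sum_cons mulrCA mulrDr.
move=> h; apply: (cvg_unique _ h) => //.
by apply: cvgMr; apply: cvgD; [exact: cvg_cst|exact: cvg_height_sum].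
Qed.

Section pair.
Variables (kappa xi eta : R).
Hypotheses (k01 : 0 <= kappa <= 55 / 100) (xi01 : 0 < xi <= 1) (eta01 : 0 < eta <= 1).

Definition height_gap x :=
  SBR_height kappa ((xi + false%:R) / 2) x - SBR_height kappa ((eta + true%:R) / 2) x.

(** The limit is taken along the indices [(3 * m).+2], at which the tail consists of complete blocks
    and [height_diff_ge] is available. *)
Lemma cvg_height_gap x : (fun m => 2 * pi * height_diff kappa
    (cons_digit false (dyadic_digits xi)) (cons_digit true (dyadic_digits eta)) x (3 * m).+2)
  @ \oo --> height_gap x.
Proof.
have k1 : `|kappa| < 1 by have /andP[k0 k1] := k01; rewrite ger0_norm//; lra.
rewrite /height_diff; under eq_fun do rewrite mulrBr.
have h3 : (fun m => (3 * m).+2)%N @ \oo --> \oo.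
  by apply/cvgnyPge => A; exists A => // n /= An; lia.
have sub (u : R^nat) (l : R) : u @ \oo --> l -> (fun m => u (3 * m).+2) @ \oo --> l.
  exact: cvg_comp h3.
have := cvg_height_sum (xi := (xi + false%:R) / 2) (x := x) k1.
have := cvg_height_sum (xi := (eta + true%:R) / 2) (x := x) k1.
rewrite !dyadic_digits_half// => h2 h1.
by apply: cvgB; [exact: sub h1|exact: sub h2].
Qed.

Lemma height_gap_ge x : 119 / 125 <= sin (pi * x) -> 2 * pi * (kappa / 200) <= height_gap x.
Proof.
move=> hs; rewrite -(cvg_lim _ (cvg_height_gap (x := x)))//.
apply: limr_ge; first exact: cvgP (cvg_height_gap (x := x)).
apply: nearW => m; apply: ler_wpM2l; first by rewrite mulr_ge0 ?pi_ge0.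
exact: height_diff_ge.
Qed.

(** A bound on increments survives the limit, so no derivative of the limiting height function has
    to be considered. *)
Lemma height_gap_slope b x y : y <= x ->
  (forall z, y <= z <= x -> 61 / 200 <= (-1) ^+ b * cos (pi * z)) ->
  2 * pi * (pi * kappa / 100) * (x - y) <= (-1) ^+ b * (height_gap x - height_gap y).
Proof.
move=> yx hz.
pose D t m := 2 * pi * height_diff kappa (cons_digit false (dyadic_digits xi))
  (cons_digit true (dyadic_digits eta)) t (3 * m).+2.
have h : (fun m => (-1) ^+ b * (D x m - D y m)) @ \oo -->
    (-1) ^+ b * (height_gap x - height_gap y).
  by apply: cvgMr; apply: cvgB; exact: cvg_height_gap.
rewrite -(cvg_lim _ h)//; apply: limr_ge; first exact: cvgP h.
apply: nearW => m; rewrite /D -mulrBr [leRHS]mulrCA -[leLHS]mulrA.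
apply: ler_wpM2l; first by rewrite mulr_ge0 ?pi_ge0.
exact: height_diff_slope.
Qed.

End pair.
End SBR_height_digits.

(** * The energy of the fibre measures *)

Section uniform_measure.
Context {R : realType}.
Local Notation leb := (@lebesgue_measure R).

Definition half_map (b : bool) (x : measurableTypeR R) : measurableTypeR R :=
  (x + b%:R) / 2.

Lemma measurable_half_map b : measurable_fun setT (half_map b).
Proof. by apply: measurable_funM => //; apply: measurable_funD. Qed.

Let half_ge0 : (0 : R) <= 2^-1. Proof. by rewrite invr_ge0. Qed.

Definition half_pushforward (m : {measure set (measurableTypeR R) -> \bar R}) b :
    {measure set (measurableTypeR R) -> \bar R} :=
  mscale (NngNum half_ge0)
    (measure_function_pushforward__canonical__measure_function_Measure
      m (measurable_half_map b)).

(** Uniqueness of Lebesgue measure reduces the claim to half-open intervals, whose preimages are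
    intervals of twice the length. *)
Lemma lebesgue_measure_half_map b A : measurable A ->
  leb A = (2^-1%:E * leb (half_map b @^-1` A))%E.
Proof.
move=> mA; rewrite (@lebesgue_measure_unique R (half_pushforward leb b))// => _ [[u v] _ <-].
rewrite /= /mscale /= /pushforward.
rewrite (_ : half_map b @^-1` _ = `]2 * u - b%:R, 2 * v - b%:R]%classic).
  rewrite !lebesgue_measure_itv /= !lte_fin.
  rewrite (_ : (2 * u - b%:R < 2 * v - b%:R) = (u < v)).
    by case: ifPn => _; rewrite ?mule0// -!EFinD -EFinM; congr EFin; lra.
  by apply/idP/idP; lra.
apply/seteqP; split => x /=; rewrite !in_itv /= /half_map => /andP[h1 h2].
  by apply/andP; split; lra.
by apply/andP; split; lra.
Qed.

(* 0 is left out because the digits of [half_map true 0 = 1/2] are 0111...,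
   so that the self-similarity of the height function fails there *)
Definition unif : set (measurableTypeR R) -> \bar R :=
  mrestr leb (measurable_itv `]0, 1]).
HB.instance Definition _ := Measure.on unif.

Lemma unif_setT : unif setT = 1%E.
Proof.
rewrite /unif /mrestr setTI lebesgue_measure_itv /= lte_fin ltr01.
by rewrite oppr0 adde0.
Qed.

HB.instance Definition _ := Measure_isProbability.Build _ _ _ unif unif_setT.

Lemma unifE A : unif A = leb (A `&` `]0, 1]%classic).
Proof. by []. Qed.

(** The cut at 1/2 separates points by their first digit, and each half is the image of []0, 1]]
    under one [half_map]. Integrating functions this way conditions on the first digit. *)
Lemma unif_halves A : measurable A -> unif A =
  (2^-1%:E * unif (half_map false @^-1` A) + 2^-1%:E * unif (half_map true @^-1` A))%E.
Proof.
move=> mA; rewrite !unifE.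
have -> : `]0, 1]%classic = `]0, 2^-1]%classic `|` `]2^-1, 1]%classic :> set R.
  by rewrite -itv_bndbnd_setU// bnd_simp; lra.
rewrite setIUr measureU//=; last 3 first.
- by apply: measurableI => //; exact: measurable_itv.
- by apply: measurableI => //; exact: measurable_itv.
- apply/seteqP; split => // x /= [[_ +] [_ +]]; rewrite !in_itv /=; lra.
rewrite (lebesgue_measure_half_map false); last by apply: measurableI => //; exact: measurable_itv.
rewrite [X in (_ + X)%E](lebesgue_measure_half_map true); last by apply: measurableI => //; exact: measurable_itv.
congr (_ * leb _ + _ * leb _)%E; rewrite preimage_setI; congr (_ `&` _);
  by apply/seteqP; split => x /=; rewrite !in_itv /= /half_map /=; lra.
Qed.

Lemma integral_unif_halves (f : measurableTypeR R -> \bar R) :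
  measurable_fun setT f -> (forall x, 0 <= f x)%E ->
  (\int[unif]_x f x = 2^-1%:E * \int[unif]_x f (half_map false x) +
    2^-1%:E * \int[unif]_x f (half_map true x))%E.
Proof.
move=> mf f0.
have muE b : (\int[half_pushforward unif b]_x f x =
    2^-1%:E * \int[unif]_x f (half_map b x))%E.
  rewrite ge0_integral_mscale//= ge0_integral_pushforward//.
  exact: measurable_half_map.
rewrite -!muE -ge0_integral_measure_add//.
by apply: eq_measure_integral => A mA _; rewrite [RHS]measure_addE; exact: unif_halves.
Qed.

Lemma ae_unif (P : R -> Prop) : (forall x, 0 < x <= 1 -> P x) ->
  {ae unif, forall x, P x}.
Proof.
move=> hP; exists (~` `]0, 1]%classic); split.
- by apply: measurableC; exact: measurable_itv.
- by rewrite unifE setICl measure0.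
- by move=> x /= nP h; apply: nP; apply: hP; rewrite in_itv in h.
Qed.

Lemma le_integral_unif (f g : measurableTypeR R -> \bar R) :
  measurable_fun setT f -> measurable_fun setT g ->
  (forall x, 0 <= f x)%E -> (forall x, 0 <= g x)%E ->
  (forall x, (0 < x <= 1)%R -> (f x <= g x)%E) -> (\int[unif]_x f x <= \int[unif]_x g x)%E.
Proof.
move=> mf mg f0 g0 fg; apply: ae_ge0_le_integral => //.
by apply: ae_unif => x /fg.
Qed.

End uniform_measure.

(** * Measure of the set where two height functions are close *)

Section gap_measure.
Context {R : realType}.
Local Notation leb := (@lebesgue_measure R).

(** The set lies in the interval of radius [D] around any of its points; the lost factor 2 only
    affects constants. *)
Lemma lebesgue_measure_diameter_le (A : set (measurableTypeR R)) (D : R) :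
  measurable A -> 0 <= D -> (forall x y, A x -> A y -> y <= x -> x - y <= D) ->
  (leb A <= (2 * D)%:E)%E.
Proof.
move=> mA D0 hA; have [->|/set0P[a Aa]] := eqVneq A set0.
  by rewrite measure0 lee_fin mulr_ge0.
apply: (@le_trans _ _ (leb `[a - D, a + D]%classic)).
  apply: le_measure; rewrite ?inE//.
  move=> x Ax; rewrite /= in_itv /=; have [xa|/ltW ax] := leP x a.
    by have := hA _ _ Aa Ax xa; lra.
  by have := hA _ _ Ax Aa ax; lra.
rewrite lebesgue_measure_itv /= lte_fin; case: ifPn => _; last by rewrite lee_fin mulr_ge0.
by rewrite -EFinD lee_fin; lra.
Qed.

Variables (kappa xi eta : R).
Hypotheses (k01 : 0 < kappa <= 55 / 100) (xi01 : 0 < xi <= 1) (eta01 : 0 < eta <= 1).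

Let k1 : `|kappa| < 1.
Proof. by have /andP[k0 k1] := k01; rewrite gtr0_norm//; lra. Qed.

Let k01' : 0 <= kappa <= 55 / 100.
Proof. by have /andP[/ltW -> ->] := k01. Qed.

Local Notation gap := (height_gap kappa xi eta).

Lemma measurable_height_gap : measurable_fun setT gap.
Proof.
have h (z : R) : measurable_fun setT (SBR_height kappa z).
  exact: (measurable_fun_pair2 z (measurable_SBR_height k1)).
by apply: measurable_funB; exact: h.
Qed.

(** The first term comes from the two regions of large slope, the second from the middle region
    where the gap is bounded below. *)
Definition gap_const : R := 400 / (pi ^+ 2 * kappa) + 100 / (pi * kappa).

Lemma gap_measure_le r : 0 <= r ->
  (unif [set x | (`|gap x| <= r)%R] <= (gap_const * r)%:E)%E.
Proof.
move=> r0; have /andP[k0 _] := k01; have pi0 := pi_gt0 R.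
pose slope : R := 2 * pi * (pi * kappa / 100).
have slope0 : 0 < slope by rewrite /slope !mulr_gt0// invr_gt0.
pose low : R := 2 * pi * (kappa / 200).
have low0 : 0 < low by rewrite /low !mulr_gt0// invr_gt0.
pose G := [set x | `|gap x| <= r].
have mG : measurable G.
  rewrite -[G]setTI; apply: (measurable_fun_le _ _) => //.
  by apply: measurableT_comp => //; exact: measurable_height_gap.
pose I : set R := `[0, 1]%classic.
have mI : measurable I by exact: measurable_itv.
pose side (b : bool) := I `&` G `&` [set x | 61 / 200 <= (-1) ^+ b * cos (pi * x)].
pose mid := I `&` G `&` [set x | 119 / 125 <= sin (pi * x)].
have mcos (b : bool) : measurable [set x : R | 61 / 200 <= (-1) ^+ b * cos (pi * x)].
  rewrite -[X in measurable X]setTI; apply: measurable_fun_le => //.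
  apply: measurable_funM => //; apply: measurableT_comp.
    exact: (continuous_measurable_fun (@continuous_cos _)).
  exact: measurable_funM.
have msin : measurable [set x : R | 119 / 125 <= sin (pi * x)].
  rewrite -[X in measurable X]setTI; apply: measurable_fun_le => //.
  apply: measurableT_comp.
    exact: (continuous_measurable_fun (@continuous_sin _)).
  exact: measurable_funM.
have mside b : measurable (side b) by do 2?apply: measurableI.
have mmid : measurable mid by do 2?apply: measurableI.
(* The three regions cover []0, 1]] because [(61 / 200) ^+ 2 + (119 / 125) ^+ 2 < 1]: a sine and a
   cosine cannot both stay below the thresholds. *)
have cover : G `&` `]0, 1]%classic `<=` side false `|` side true `|` mid.
  move=> x [Gx]; rewrite /= in_itv /= => /andP[x0 x1].
  have Ix : I x by rewrite /I /= in_itv /= x1 ltW.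
  have s0 : 0 <= sin (pi * x).
    by apply: sin_ge0_pi; rewrite mulr_ge0 ?(ltW pi0) ?(ltW x0)//= ler_piMr// ltW.
  have [h1|h1] := leP (61 / 200) (cos (pi * x)).
    by left; left; split => //=; rewrite expr0 mul1r.
  have [h2|h2] := leP (61 / 200) (- cos (pi * x)).
    by left; right; split => //=; rewrite expr1 mulN1r.
  right; split => //=; rewrite leNgt; apply/negP => h3.
  have := cos2Dsin2 (pi * x); rewrite !expr2; nra.
have diam b x y : side b x -> side b y -> y <= x -> x - y <= 2 * r / slope.
  move=> [[Ix Gx] cx] [[Iy Gy] cy] yx; rewrite ler_pdivlMr// mulrC.
  have := @height_gap_slope _ kappa xi eta k01' xi01 eta01 b x y yx.
  move=> /(_ _)/le_trans; apply.
    move: Ix Iy cx cy; rewrite /I /= !in_itv /= => /andP[x0 x1] /andP[y0 y1] cx cy.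
    move=> z /andP[yz zx].
    have ipi (t : R) : y <= t <= x -> pi * t \in `[0, pi].
      move=> /andP[yt tx]; rewrite in_itv /= mulr_ge0 ?(ltW pi0) ?(le_trans y0)//=.
      by rewrite ler_piMr ?(ltW pi0)// (le_trans tx).
    have ix : pi * x \in `[0, pi] by apply: ipi; rewrite yx lexx.
    have iy : pi * y \in `[0, pi] by apply: ipi; rewrite yx lexx.
    have iz : pi * z \in `[0, pi] by apply: ipi; rewrite yz zx.
    (* The cosine decreases on [[0, pi]], so its bounds at the endpoints [x] and [y] extend to every
       point between them. *)
    have h1 : cos (pi * x) <= cos (pi * z).
      by rewrite leNgt ltr_cos// -leNgt ler_pM2l.
    have h2 : cos (pi * z) <= cos (pi * y).
      by rewrite leNgt ltr_cos// -leNgt ler_pM2l.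
    by case: (b) cx cy; rewrite ?expr0 ?expr1 ?mul1r ?mulN1r => cx cy; lra.
  move: Gx Gy; rewrite /G /= !ler_norml => /andP[g1 g2] /andP[g3 g4].
  by case: (b); rewrite ?expr0 ?expr1 ?mul1r ?mulN1r; lra.
have D0 : 0 <= 2 * r / slope by rewrite divr_ge0 ?mulr_ge0// ltW.
have hside b : (leb (side b) <= (2 * (2 * r / slope))%:E)%E.
  exact: lebesgue_measure_diameter_le (mside b) D0 (diam b).
(* For [r < low] the middle region misses the set entirely; for larger [r] the trivial bound 1 is
   already at most [r / low]. *)
have hmid : (leb mid <= (r / low)%:E)%E.
  have [rlow|rlow] := ltP r low.
    rewrite (_ : mid = set0) ?measure0 ?lee_fin ?divr_ge0// ?ltW//.
    apply/seteqP; split => // x [[Ix Gx] sx]; exfalso.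
    have := @height_gap_ge _ kappa xi eta k01' xi01 eta01 x sx.
    by move: Gx; rewrite /G /= ler_norml -/low => /andP[_ g]; lra.
  apply: (@le_trans _ _ (leb I)).
    by apply: le_measure; rewrite ?inE// => x [[]].
  rewrite lebesgue_measure_itv /= lte_fin ltr01 oppr0 adde0 lee_fin.
  by rewrite ler_pdivlMr// mul1r.
rewrite unifE; apply: (@le_trans _ _ (leb (side false `|` side true `|` mid))).
  apply: le_measure => //; rewrite inE.
    by apply: measurableI => //; exact: measurable_itv.
  exact: measurableU (measurableU _ _ (mside _) (mside _)) mmid.
have mS : measurable (side false `|` side true) by exact: measurableU (mside _) (mside _).
apply: (le_trans (measureU2 leb mS mmid)).
apply: (le_trans (leeD (measureU2 leb (mside false) (mside true)) (lexx _))).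
apply: le_trans (leeD (leeD (hside false) (hside true)) hmid) _.
rewrite -!EFinD lee_fin /gap_const /slope /low le_eqVlt; apply/orP; left; apply/eqP.
have := gt_eqF pi0; have := gt_eqF k0; move: (@pi R) => p k_neq0 p_neq0.
by field; rewrite k_neq0 p_neq0.
Qed.

End gap_measure.

(** * The energy recursion and its solution *)

Section energy.
Context {R : realType}.
Local Notation mR := (measurableTypeR R).
Variable kappa : R.
Hypothesis k01 : 1 / 2 < kappa <= 55 / 100.
Local Notation S := (SBR_height kappa).
Local Open Scope ereal_scope.

Let k_lt1 : (`|kappa| < 1)%R.
Proof. by have /andP[ka kb] := k01; rewrite gtr0_norm; lra. Qed.

Let k0 : (0 < kappa)%R.
Proof. by have /andP[ka kb] := k01; lra. Qed.

Let kP : (0 < kappa <= 55 / 100)%R.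
Proof. by have /andP[ka kb] := k01; lra. Qed.

Definition close_indic (r t : R) : \bar R := (\1_[set s | (`|s| <= r)%R] t)%:E.

Lemma close_ge0 r t : 0 <= close_indic r t.
Proof. by rewrite lee_fin. Qed.

Lemma close_le1 r t : close_indic r t <= 1.
Proof. by rewrite lee_fin indicE; case: (_ \in _). Qed.

Lemma measurable_close r : measurable_fun setT (close_indic r : mR -> \bar R).
Proof.
apply/measurable_EFinP/measurable_indic.
by rewrite -[X in measurable X]setTI; apply: measurable_fun_le.
Qed.

(** The reparametrisations [f1], [f2], [g] let one measurability argument serve the energy itself,
    where they are identities, and its restrictions to first digits, where they are half maps. The
    coordinates are ordered as [((x, xi), eta)]. *)
Let P r f1 f2 g (z : mR * mR * mR) :=
  close_indic r (S (f1 z.1.2) (g z.1.1) - S (f2 z.2) (g z.1.1))%R.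

Section measurability.
Variables (r : R) (f1 f2 g : mR -> mR).
Hypotheses (mf1 : measurable_fun setT f1) (mf2 : measurable_fun setT f2)
  (mg : measurable_fun setT g).

Let measurable_P : measurable_fun setT (P r f1 f2 g).
Proof.
apply: measurableT_comp; first exact: measurable_close.
apply: measurable_funB.
- apply: (measurableT_comp (measurable_SBR_height k_lt1)
    (_ : measurable_fun setT (fun z : mR * mR * mR => (f1 z.1.2, g z.1.1)))).
  apply: measurable_fun_pair; apply: measurableT_comp => //.
  + exact: (measurableT_comp measurable_snd measurable_fst).
  + exact: (measurableT_comp measurable_fst measurable_fst).
- apply: (measurableT_comp (measurable_SBR_height k_lt1)
    (_ : measurable_fun setT (fun z : mR * mR * mR => (f2 z.2, g z.1.1)))).
  apply: measurable_fun_pair; apply: measurableT_comp => //.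
  exact: (measurableT_comp measurable_fst measurable_fst).
Qed.

Let P1 (z : mR * mR) := \int[unif]_eta P r f1 f2 g (z, eta).

Let P1_ge0 z : 0 <= P1 z.
Proof. by apply: integral_ge0 => eta _; exact: close_ge0. Qed.

Let measurable_P1 : measurable_fun setT P1.
Proof.
apply: (@measurable_fun_fubini_tonelli_F _ _ _ _ _ unif) => //.
by move=> z; exact: close_ge0.
Qed.

Lemma measurable_int_close x xi :
  measurable_fun setT (fun eta => close_indic r (S (f1 xi) (g x) - S (f2 eta) (g x))%R).
Proof. exact: (measurable_fun_pair2 (x, xi) measurable_P). Qed.

Lemma measurable_int2_close x :
  measurable_fun setT (fun xi => \int[unif]_eta close_indic r (S (f1 xi) (g x) - S (f2 eta) (g x))%R).
Proof. exact: (measurable_fun_pair2 x measurable_P1). Qed.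

Lemma measurable_int3_close : measurable_fun setT (fun x =>
  \int[unif]_xi \int[unif]_eta close_indic r (S (f1 xi) (g x) - S (f2 eta) (g x))%R).
Proof. exact: (@measurable_fun_fubini_tonelli_F _ _ _ _ _ unif P1). Qed.

(** Two applications of Tonelli make [x] the innermost variable, as transversality controls the
    integral over [x] for fixed [xi] and [eta]. *)
Lemma int_close_swap :
  \int[unif]_x \int[unif]_xi \int[unif]_eta close_indic r (S (f1 xi) (g x) - S (f2 eta) (g x))%R =
  \int[unif]_xi \int[unif]_eta \int[unif]_x close_indic r (S (f1 xi) (g x) - S (f2 eta) (g x))%R.
Proof.
transitivity (\int[unif]_xi \int[unif]_x P1 (x, xi)).
  exact: (@fubini_tonelli _ _ _ _ _ unif unif P1).
apply: eq_integral => xi _.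
apply: (@fubini_tonelli _ _ _ _ _ unif unif (fun z => P r f1 f2 g ((z.1, xi), z.2))).
  apply: (measurableT_comp measurable_P).
  apply: measurable_fun_pair => //; apply: measurable_fun_pair => //.
by move=> z; exact: close_ge0.
Qed.

(** The same integrand with coordinates ordered as [((xi, eta), x)], for the swapped iterated
    integrals. *)
Let Q (z : mR * mR * mR) := P r f1 f2 g ((z.2, z.1.1), z.1.2).

Let measurable_Q : measurable_fun setT Q.
Proof.
apply: (measurableT_comp measurable_P).
apply: measurable_fun_pair; last exact: (measurableT_comp measurable_snd measurable_fst).
apply: measurable_fun_pair => //.
exact: (measurableT_comp measurable_fst measurable_fst).
Qed.

Let Q1 (z : mR * mR) := \int[unif]_x Q (z, x).

Let measurable_Q1 : measurable_fun setT Q1.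
Proof.
apply: (@measurable_fun_fubini_tonelli_F _ _ _ _ _ unif Q measurable_Q).
by move=> z; exact: close_ge0.
Qed.

Lemma measurable_int_close_swap xi : measurable_fun setT
  (fun eta => \int[unif]_x close_indic r (S (f1 xi) (g x) - S (f2 eta) (g x))%R).
Proof. exact: (measurable_fun_pair2 xi measurable_Q1). Qed.

Lemma measurable_int2_close_swap : measurable_fun setT
  (fun xi => \int[unif]_eta \int[unif]_x close_indic r (S (f1 xi) (g x) - S (f2 eta) (g x))%R).
Proof.
apply: (@measurable_fun_fubini_tonelli_F _ _ _ _ _ unif Q1 measurable_Q1).
by move=> z; apply: integral_ge0 => x _; exact: close_ge0.
Qed.

End measurability.

Definition energy r :=
  \int[unif]_x \int[unif]_xi \int[unif]_eta close_indic r (S xi x - S eta x)%R.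

Lemma integral_unif_le1 (f : mR -> \bar R) : measurable_fun setT f ->
  (forall x, 0 <= f x) -> (forall x, f x <= 1) -> \int[unif]_x f x <= 1.
Proof.
move=> mf f0 f1; apply: (@le_trans _ _ (\int[unif]_x (cst 1 x))).
  by apply: ge0_le_integral => // x _; exact: lee01.
by rewrite integral_cst// mul1e [leLHS]unif_setT.
Qed.

Lemma integral_unif_le (f : mR -> \bar R) (c : R) : measurable_fun setT f ->
  (forall x, 0 <= f x) -> (0 <= c)%R -> (forall x, (0 < x <= 1)%R -> f x <= c%:E) ->
  \int[unif]_x f x <= c%:E.
Proof.
move=> mf f0 c0 fc; apply: (@le_trans _ _ (\int[unif]_x (cst c%:E x))).
  by apply: le_integral_unif => // x; rewrite lee_fin.
by rewrite integral_cst// [X in _ * X]unif_setT mule1.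
Qed.

Lemma eq_integral_unif (f g : mR -> \bar R) :
  measurable_fun setT f -> measurable_fun setT g ->
  (forall x, 0 <= f x) -> (forall x, 0 <= g x) ->
  (forall x, (0 < x <= 1)%R -> f x = g x) -> \int[unif]_x f x = \int[unif]_x g x.
Proof.
move=> mf mg f0 g0 fg; apply/eqP; rewrite eq_le.
by apply/andP; split; apply: le_integral_unif => // x /fg ->.
Qed.

Lemma integral_unif_half2 (f g : mR -> \bar R) :
  measurable_fun setT f -> measurable_fun setT g ->
  (forall x, 0 <= f x) -> (forall x, 0 <= g x) ->
  \int[unif]_x (2^-1%:E * f x + 2^-1%:E * g x) =
  2^-1%:E * \int[unif]_x f x + 2^-1%:E * \int[unif]_x g x.
Proof.
move=> mf mg f0 g0; have h0 : 0 <= 2^-1%:E :> \bar R by rewrite lee_fin invr_ge0.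
rewrite ge0_integralD//; last 4 first.
- by move=> x _; exact: mule_ge0.
- exact: measurable_funeM.
- by move=> x _; exact: mule_ge0.
- exact: measurable_funeM.
by rewrite !ge0_integralZl.
Qed.

Lemma energy_le1 r : energy r <= 1.
Proof.
apply: integral_unif_le1 => [|x|x]; first exact: measurable_int3_close.
  by do 2!(apply: integral_ge0 => ? _); exact: close_ge0.
apply: integral_unif_le1 => [|xi|xi]; first exact: measurable_int2_close.
  by apply: integral_ge0 => ? _; exact: close_ge0.
apply: integral_unif_le1 => [|eta|eta]; first exact: measurable_int_close.
  exact: close_ge0.
exact: close_le1.
Qed.

(** The energy conditioned on first digits [a] for [xi] and [b] for [eta], at a fixed base point
    [x]. *)
Let cell_at a b r (x : mR) := \int[unif]_xi \int[unif]_eta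
  close_indic r (S (half_map a xi) x - S (half_map b eta) x)%R.

Let cell a b r := \int[unif]_x cell_at a b r x.

Let cell_at_ge0 a b r x : 0 <= cell_at a b r x.
Proof. by do 2!(apply: integral_ge0 => ? _); exact: close_ge0. Qed.

Let measurable_cell_at a b r : measurable_fun setT (cell_at a b r).
Proof.
by apply: measurable_int3_close => //; exact: measurable_half_map.
Qed.

Lemma energy_cells r : energy r =
  2^-1%:E * (2^-1%:E * cell false false r + 2^-1%:E * cell false true r) +
  2^-1%:E * (2^-1%:E * cell true false r + 2^-1%:E * cell true true r).
Proof.
pose row a (x : mR) := 2^-1%:E * cell_at a false r x + 2^-1%:E * cell_at a true r x.
have mh := @measurable_half_map R.
have h0 : 0 <= 2^-1%:E :> \bar R by rewrite lee_fin invr_ge0.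
have row_ge0 a x : 0 <= row a x by rewrite adde_ge0// mule_ge0.
have mrow a : measurable_fun setT (row a).
  by apply: emeasurable_funD; apply: measurable_funeM; exact: measurable_cell_at.
have rowI a : \int[unif]_x row a x = 2^-1%:E * cell a false r + 2^-1%:E * cell a true r.
  by apply: integral_unif_half2 => //; exact: measurable_cell_at.
transitivity (\int[unif]_x (2^-1%:E * row false x + 2^-1%:E * row true x)); last first.
  rewrite integral_unif_half2//.
  by congr (_ * _ + _ * _); exact: rowI.
apply: eq_integral => x _.
rewrite integral_unif_halves; last 2 first.
- exact: measurable_int2_close.
- by move=> xi; apply: integral_ge0 => ? _; exact: close_ge0.
have rowE a : \int[unif]_xi \int[unif]_eta close_indic r (S (half_map a xi) x - S eta x)%R = row a x.
  rewrite /row /cell_at -integral_unif_half2; last 4 first.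
  - by apply: measurable_int2_close => //; exact: mh.
  - by apply: measurable_int2_close => //; exact: mh.
  - by move=> xi; apply: integral_ge0 => ? _; exact: close_ge0.
  - by move=> xi; apply: integral_ge0 => ? _; exact: close_ge0.
  apply: eq_integral => xi _; rewrite integral_unif_halves//.
    apply: (@measurable_int_close r (half_map a) id id) => //; exact: mh.
  by move=> eta; exact: close_ge0.
by congr (_ * _ + _ * _); exact: rowE.
Qed.

(** With a common first digit the sine terms cancel, and the common factor [kappa] rescales the
    radius. *)
Lemma close_half b r x xi eta : (0 < xi <= 1)%R -> (0 < eta <= 1)%R ->
  close_indic r (S (half_map b xi) x - S (half_map b eta) x)%R =
  close_indic (r / kappa) (S xi (half_map b x) - S eta (half_map b x))%R.
Proof.
move=> xi01 eta01; rewrite {1 2}/half_map !SBR_height_half// -mulrBr opprD addrACA subrr add0r.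
rewrite /close_indic !indicE; congr (EFin (nat_of_bool _)%:R).
by apply/idP/idP; rewrite !inE /= normrM gtr0_norm// ler_pdivlMr// mulrC.
Qed.

Lemma cell_diag b r : cell b b r =
  \int[unif]_x \int[unif]_xi \int[unif]_eta
    close_indic (r / kappa) (S xi (half_map b x) - S eta (half_map b x))%R.
Proof.
have mh := @measurable_half_map R.
apply: eq_integral => x _; apply: eq_integral_unif.
- apply: (@measurable_int2_close r (half_map b) (half_map b) id) => //; exact: mh.
- apply: (@measurable_int2_close (r / kappa)%R id id (half_map b)) => //; exact: mh.
- by move=> xi; apply: integral_ge0 => ? _; exact: close_ge0.
- by move=> xi; apply: integral_ge0 => ? _; exact: close_ge0.
move=> xi xi01; apply: eq_integral_unif.
- apply: (@measurable_int_close r (half_map b) (half_map b) id) => //; exact: mh.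
- apply: (@measurable_int_close (r / kappa)%R id id (half_map b)) => //; exact: mh.
- by move=> eta; exact: close_ge0.
- by move=> eta; exact: close_ge0.
by move=> eta eta01; exact: close_half.
Qed.

Lemma integral_close_gap r xi eta : (0 <= r)%R -> (0 < xi <= 1)%R -> (0 < eta <= 1)%R ->
  \int[unif]_x close_indic r (height_gap kappa xi eta x) <= (gap_const kappa * r)%:E.
Proof.
move=> r0 xi01 eta01.
have mG : measurable [set x : mR | (`|height_gap kappa xi eta x| <= r)%R].
  rewrite -[X in measurable X]setTI; apply: measurable_fun_le => //.
  by apply: measurableT_comp => //; exact: measurable_height_gap.
pose G := [set x : mR | (`|height_gap kappa xi eta x| <= r)%R].
apply: (@le_trans _ _ (\int[unif]_x (\1_G x)%:E)).
  by rewrite le_eqVlt; apply/orP; left; apply/eqP; apply: eq_integral.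
by rewrite integral_indic// setIT; exact: gap_measure_le.
Qed.

Let gap_const_ge0 : (0 <= gap_const kappa)%R.
Proof.
have p0 : (0 <= pi :> R)%R by exact: pi_ge0.
have c0 : (0 <= kappa)%R by rewrite ltW.
apply: addr_ge0; apply: divr_ge0; try exact: ler0n; apply: mulr_ge0 => //.
exact: exprn_ge0.
Qed.

Lemma cell_offdiag b r : (0 <= r)%R -> cell b (~~ b) r <= (gap_const kappa * r)%:E.
Proof.
move=> r0; have mh := @measurable_half_map R.
have c0 : (0 <= gap_const kappa * r)%R by exact: mulr_ge0.
have swapped_le c xi eta : (0 < xi <= 1)%R -> (0 < eta <= 1)%R ->
    \int[unif]_x close_indic r (S (half_map c xi) x - S (half_map (~~ c) eta) x)%R
    <= (gap_const kappa * r)%:E.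
  (* [height_gap] fixes the order of the digits; the other order follows by exchanging [xi] and
     [eta], as the absolute value is symmetric. *)
  move=> xi01 eta01; case: c; last exact: integral_close_gap.
  rewrite (_ : \int[unif]_x _ = \int[unif]_x close_indic r (height_gap kappa eta xi x)).
    exact: integral_close_gap.
  apply: eq_integral => x _; rewrite /close_indic !indicE; congr (EFin (nat_of_bool _)%:R).
  by apply/idP/idP; rewrite !inE /= distrC.
rewrite (_ : cell b (~~ b) r = \int[unif]_xi \int[unif]_eta \int[unif]_x
  close_indic r (S (half_map b xi) x - S (half_map (~~ b) eta) x)%R); last first.
  by apply: (@int_close_swap r (half_map b) (half_map (~~ b)) id) => //; exact: mh.
apply: integral_unif_le => //.
- by apply: (@measurable_int2_close_swap r (half_map b) (half_map (~~ b)) id) => //; exact: mh.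
- by move=> xi; do 2!(apply: integral_ge0 => ? _); exact: close_ge0.
move=> xi xi01; apply: integral_unif_le => //.
- by apply: (@measurable_int_close_swap r (half_map b) (half_map (~~ b)) id) => //; exact: mh.
- by move=> eta; apply: integral_ge0 => ? _; exact: close_ge0.
by move=> eta eta01; exact: swapped_le.
Qed.

(** The upper bounds exclude infinite values, so that the inequality becomes linear arithmetic over
    the reals. *)
Lemma quarter_sum_le (a b c d : \bar R) (m : R) :
  0 <= a <= 1 -> 0 <= b <= m%:E -> 0 <= c <= m%:E -> 0 <= d <= 1 ->
  2^-1%:E * (2^-1%:E * a + 2^-1%:E * b) + 2^-1%:E * (2^-1%:E * c + 2^-1%:E * d) <=
  2^-1%:E * (2^-1%:E * a + 2^-1%:E * d) + (2^-1 * m)%:E.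
Proof.
case: a => [a| |]; rewrite ?leye_eq ?andbF// => _.
case: b => [b| |]; rewrite ?leye_eq ?andbF// => /andP[_ bm].
case: c => [c| |]; rewrite ?leye_eq ?andbF// => /andP[_ cm].
case: d => [d| |]; rewrite ?leye_eq ?andbF// => _.
rewrite !lee_fin in bm cm.
by rewrite -?EFinM -?EFinD -?EFinM -?EFinD lee_fin; lra.
Qed.

Let cell_le1 a b r : cell a b r <= 1.
Proof.
have mh := @measurable_half_map R.
apply: integral_unif_le1 => [|//|x]; first exact: measurable_cell_at.
apply: integral_unif_le1 => [|xi|xi].
- by apply: (@measurable_int2_close r (half_map a) (half_map b) id) => //; exact: mh.
- by apply: integral_ge0 => ? _; exact: close_ge0.
apply: integral_unif_le1 => [|eta|eta].
- by apply: (@measurable_int_close r (half_map a) (half_map b) id) => //; exact: mh.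
- exact: close_ge0.
exact: close_le1.
Qed.

Let cell_ge0 a b r : 0 <= cell a b r.
Proof. by apply: integral_ge0 => x _. Qed.

Lemma energy_rec r : (0 <= r)%R ->
  energy r <= 2^-1%:E * energy (r / kappa) + (2^-1 * gap_const kappa * r)%:E.
Proof.
move=> r0; have h0 : 0 <= 2^-1%:E :> \bar R by rewrite lee_fin invr_ge0.
pose diag (x : mR) := \int[unif]_xi \int[unif]_eta
  close_indic (r / kappa) (S xi x - S eta x)%R.
(* In the cell of common digit [b] the base point is [half_map b x]; averaging over [b] therefore
   recovers the integral over all [x]. *)
have E1 : energy (r / kappa) = 2^-1%:E * cell false false r + 2^-1%:E * cell true true r.
  have D b : cell b b r = \int[unif]_x diag (half_map b x) by exact: cell_diag.
  have md : measurable_fun setT diag.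
    exact: (@measurable_int3_close (r / kappa)%R id id id).
  have d0 x : 0 <= diag x by do 2!(apply: integral_ge0 => ? _); exact: close_ge0.
  rewrite (D false) (D true); exact: integral_unif_halves.
rewrite E1 energy_cells -mulrA; apply: quarter_sum_le; rewrite cell_ge0 /=.
- exact: cell_le1.
- exact: (cell_offdiag false).
- exact: (cell_offdiag true).
- exact: cell_le1.
Qed.

(** After [n] steps the radius is [r / kappa ^+ n] with weight [2^-1 ^+ n], so the errors form a
    geometric series of ratio [q = 1 / (2 * kappa) < 1]. Its sum [2 * kappa / (2 * kappa - 1)] gives
    the constant, and [energy_le1] makes the remainder vanish. *)
Lemma energy_le r : (0 <= r)%R ->
  energy r <= (gap_const kappa * kappa / (2 * kappa - 1) * r)%:E.
Proof.
move=> r0; pose q : R := ((2 * kappa)^-1)%R.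
have /andP[ka kb] := k01.
have q0 : (0 <= q)%R by rewrite /q invr_ge0; lra.
have q1 : (q < 1)%R by rewrite /q invf_lt1; lra.
have kq : (2 * kappa * q = 1)%R by rewrite /q mulfV// gt_eqF//; lra.
have iter n s : (0 <= s)%R -> energy s <=
    ((\sum_(i < n) q ^+ i) * (2^-1 * gap_const kappa * s) + 2^-1 ^+ n)%:E.
  elim: n s => [|n IH] s s0.
    by rewrite big_ord0 mul0r add0r expr0; exact: energy_le1.
  apply: le_trans (energy_rec s0) _.
  have sk0 : (0 <= s / kappa)%R by apply: divr_ge0 => //; lra.
  have h0 : 0 <= 2^-1%:E :> \bar R by rewrite lee_fin invr_ge0.
  apply: le_trans (leeD (lee_wpmul2l h0 (IH _ sk0)) (lexx _)) _.
  have sumS : (\sum_(i < n.+1) q ^+ i = 1 + q * \sum_(i < n) q ^+ i)%R.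
    by rewrite big_ord_recl expr0 mulr_sumr; congr (_ + _)%R; apply: eq_bigr => i _; rewrite -exprS.
  rewrite -EFinM -EFinD lee_fin sumS le_eqVlt; apply/orP; left; apply/eqP.
  rewrite exprS /q invfM; move: (\sum_(i < n) _)%R (2^-1 ^+ n)%R => G H.
  by move: (kappa^-1)%R (gap_const kappa) => k g; ring.
have bound n : energy r <=
    (gap_const kappa * kappa / (2 * kappa - 1) * r + 2^-1 ^+ n)%:E.
  apply: le_trans (iter n r r0) _; rewrite lee_fin lerD2r.
  have := sum_geometric_le n q0; set G := (\sum_(i < n) _)%R => hG.
  have k2 : (0 < 2 * kappa - 1)%R by lra.
  rewrite [leRHS]mulrAC ler_pdivlMr//.
  have -> : (2 * kappa - 1 = 2 * kappa * (1 - q))%R by rewrite mulrBr kq mulr1.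
  have -> : (G * (2^-1 * gap_const kappa * r) * (2 * kappa * (1 - q)) =
     gap_const kappa * kappa * r * (G * (1 - q)))%R by lra.
  rewrite ler_piMr// mulr_ge0// mulr_ge0//; lra.
apply/lee_addgt0Pr => e e0.
have [n hn] : exists n, (2^-1 ^+ n <= e :> R)%R.
  have : (fun n => 2^-1 ^+ n : R)%R @ \oo --> (0 : R)%R.
    by apply: cvg_expr; rewrite ger0_norm; lra.
  move=> /cvgr0Pnorm_le /(_ _ e0) [n _ /(_ n (leqnn n))] /= h.
  by exists n; exact: le_trans (ler_norm _) h.
by apply: le_trans (bound n) _; rewrite EFinD leeD2l// lee_fin.
Qed.

End energy.

(** * Dyadic martingale of densities *)

Section grid.
Context {R : realType}.
Local Notation mR := (measurableTypeR R).
Implicit Types (y s : mR) (n : nat).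

Definition grid n y : int := Num.floor (2 ^+ n * y : R).

Lemma grid_itv n y (k : int) : (grid n y == k) = (k%:~R / 2 ^+ n <= y < (k + 1)%:~R / 2 ^+ n).
Proof.
have p0 : (0 < 2 ^+ n :> R) by rewrite exprn_gt0.
by rewrite /grid floor_eq ler_pdivrMr// ltr_pdivlMr// mulrC.
Qed.

(** The floor of [t] is determined by the floor of [2 * t]: dyadic cells are nested. *)
Lemma grid_coarsen n y s : grid n.+1 y = grid n.+1 s -> grid n y = grid n s.
Proof.
have p0 : (0 < 2 ^+ n :> R) by rewrite exprn_gt0.
have half t : grid n t = Num.floor ((grid n.+1 t)%:~R / 2 : R).
  apply/eqP; rewrite eq_sym floor_eq.
  have /andP[h1 h2] := floor_itv (2 ^+ n * t : R).
  rewrite /grid; set k := Num.floor (2 ^+ n * t : R) in h1 h2 *.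
  rewrite ler_pdivlMr// ltr_pdivrMr//.
  have -> : k%:~R * 2 = (k * 2)%:~R :> R by rewrite intrM.
  have -> : (k + 1)%:~R * 2 = (k * 2 + 2)%:~R :> R by rewrite !intrD intrM; lra.
  rewrite ler_int ltr_int floor_ge_int floor_lt_int exprS -mulrA.
  by rewrite intrD intrM; rewrite intrD in h2; apply/andP; split; lra.
by rewrite !half => ->.
Qed.

Lemma grid_coarser n k y s : (n <= k)%N -> grid k y = grid k s -> grid n y = grid n s.
Proof.
move=> /subnKC <-; elim: (k - n)%N => [|j IH]; first by rewrite addn0.
by rewrite addnS => /grid_coarsen /IH.
Qed.

Lemma measurable_grid n : measurable_fun setT (fun y => (grid n y)%:~R : mR).
Proof.
apply: nondecreasing_measurable => // x y xy.
by rewrite ler_int le_floor// ler_pM2l ?exprn_gt0.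
Qed.

(** Comparing the indices as real numbers reduces measurability in both arguments to that of the
    monotone step function [grid]. *)
Definition same_cell n y s : \bar R := (\1_[set 0 : mR] ((grid n y)%:~R - (grid n s)%:~R : mR))%:E.

Lemma same_cellE n y s : same_cell n y s = ((grid n y == grid n s)%:R)%:E.
Proof.
rewrite /same_cell indicE; congr (EFin (nat_of_bool _)%:R).
apply/idP/idP; rewrite inE /=; last by move=> /eqP ->; rewrite subrr.
by move=> /eqP; rewrite subr_eq0 => /eqP/intr_inj ->.
Qed.

Lemma same_cell_ge0 n y s : (0 <= same_cell n y s)%E.
Proof. by rewrite lee_fin. Qed.

Lemma same_cell_le1 n y s : (same_cell n y s <= 1)%E.
Proof. by rewrite same_cellE lee_fin; case: (_ == _). Qed.

Lemma same_cell_le_close n y s : (same_cell n y s <= close_indic (2 ^- n) (y - s))%E.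
Proof.
rewrite same_cellE /close_indic indicE lee_fin ler_nat.
have [e|//] := eqVneq (grid n y) (grid n s).
rewrite mem_set//=.
have p0 : (0 < 2 ^+ n :> R) by rewrite exprn_gt0.
have := grid_itv n y (grid n y); rewrite eqxx => /esym/andP[h1 h2].
have := grid_itv n s (grid n y); rewrite e eqxx -e => /esym/andP[h3 h4].
rewrite ler_norml; move: h2 h4; rewrite intrD !mulrDl mul1r => h2 h4.
by apply/andP; split; lra.
Qed.

Lemma measurable_same_cell d (T : measurableType d) n (f g : T -> mR) :
  measurable_fun setT f -> measurable_fun setT g ->
  measurable_fun setT (fun t => same_cell n (f t) (g t)).
Proof.
move=> mf mg; apply/measurable_EFinP.
apply: (measurableT_comp (measurable_indic (measurable_set1 0))).
by apply: measurable_funB; apply: (measurableT_comp (measurable_grid n)).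
Qed.

Lemma integral_same_cell n s :
  (\int[@lebesgue_measure R]_y same_cell n s y = (2 ^- n)%:E)%E.
Proof.
have p0 : (0 < 2 ^+ n :> R) by rewrite exprn_gt0.
pose i : interval R := `[(grid n s)%:~R / 2 ^+ n, (grid n s + 1)%:~R / 2 ^+ n[.
pose I : set mR := [set` i].
transitivity (\int[@lebesgue_measure R]_y (\1_I y)%:E)%E.
  apply: eq_integral => y _; rewrite same_cellE indicE; congr (EFin (nat_of_bool _)%:R).
  rewrite eq_sym grid_itv; apply/idP/idP.
    by move=> h; rewrite inE /I /= in_itv /=.
  by rewrite inE /I /= in_itv /=.
rewrite integral_indic//; last exact: measurable_itv.
rewrite setIT [LHS](lebesgue_measure_itv i) /= lte_fin ltr_pM2r ?invr_gt0// ltr_int ltzD1 lexx.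
by rewrite -EFinB intrD mulrDl addrAC subrr add0r mul1r.
Qed.

End grid.

(** * Averaged fibre densities as an L2-bounded martingale *)

Section slices.
Local Open Scope ereal_scope.
Context d1 d2 (T : measurableType d1) (X : measurableType d2) (R : realType).
Local Notation mR := (measurableTypeR R).
Local Notation leb := (@lebesgue_measure R).
Variables (P : probability T R) (m : probability X R) (S : T -> X -> mR).
Hypothesis mS : measurable_fun setT (fun z : T * X => S z.1 z.2).
Local Notation nu := (m \x leb).

(** The integral of [phi] against the law of [(x, S t x)], which in the application is the
    Sinai-Bowen-Ruelle measure. *)
Definition graph_mean (phi : X * mR -> \bar R) := \int[m]_x \int[P]_t phi (x, S t x).

(** The mass that the law of [S t x] gives to the level-[n] dyadic cell of the second coordinate,
    divided by the length of the cell. *)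
Definition slice n (z : X * mR) : \bar R :=
  (2 ^+ n)%:E * \int[P]_t same_cell n (S t z.1) z.2.

Definition grid_invariant n (phi : X * mR -> \bar R) :=
  forall x y s, grid n y = grid n s -> phi (x, y) = phi (x, s).

Lemma measurable_section x : measurable_fun setT (fun t => S t x).
Proof. exact: (measurable_fun_pair1 x mS). Qed.

Let mcell n : measurable_fun setT
  (fun w : X * mR * T => same_cell n (S w.2 w.1.1) w.1.2).
Proof.
apply: measurable_same_cell; last exact: (measurableT_comp measurable_snd measurable_fst).
apply: (measurableT_comp mS (_ : measurable_fun setT (fun w : X * mR * T => (w.2, w.1.1)))).
apply: measurable_fun_pair; first exact: measurable_snd.
exact: (measurableT_comp measurable_fst measurable_fst).
Qed.

Lemma measurable_cell_section n x y :
  measurable_fun setT (fun t => same_cell n (S t x) y).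
Proof. by apply: measurable_same_cell => //; exact: measurable_section. Qed.

Lemma slice_ge0 n z : 0 <= slice n z.
Proof. by apply: mule_ge0 => //; apply: integral_ge0 => t _; exact: same_cell_ge0. Qed.

Lemma slice_le n z : slice n z <= (2 ^+ n)%:E.
Proof.
rewrite -[leRHS]mule1; apply: lee_wpmul2l => //.
apply: (@le_trans _ _ (\int[P]_t (cst 1 t))).
  apply: ge0_le_integral => //.
  - by move=> t _; exact: same_cell_ge0.
  - exact: measurable_cell_section.
  - by move=> t _; exact: same_cell_le1.
by rewrite integral_cst// mul1e [leLHS]probability_setT.
Qed.

Lemma measurable_slice n : measurable_fun setT (slice n).
Proof.
apply: measurable_funeM.
apply: (@measurable_fun_fubini_tonelli_F _ _ _ _ _ P _ (mcell n)).
by move=> w; exact: same_cell_ge0.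
Qed.

Lemma slice_grid_invariant n : grid_invariant n (slice n).
Proof.
move=> x y s ys; rewrite /slice /=; congr (_ * _); apply: eq_integral => t _.
by rewrite !same_cellE ys.
Qed.

Lemma grid_invariantS n k phi : (n <= k)%N -> grid_invariant n phi -> grid_invariant k phi.
Proof. by move=> nk h x y s ys; apply: h; exact: grid_coarser ys. Qed.

(** The function [slice n] is a density as far as level-[n] functions can see. After exchanging [y]
    and [t], [phi] is constant on the cell of [S t x], whose length [2 ^- n] cancels the
    normalisation. *)
Lemma integral_slice n (phi : X * mR -> \bar R) :
  measurable_fun setT phi -> (forall z, 0 <= phi z) -> grid_invariant n phi ->
  \int[nu]_z (phi z * slice n z) = graph_mean phi.
Proof.
move=> mphi phi0 inv.
have ms := measurable_slice n.
rewrite (@fubini_tonelli1 _ _ _ _ _ m leb); first last.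
- by move=> z; rewrite mule_ge0// slice_ge0.
- exact: emeasurable_funM.
apply: eq_integral => x _; rewrite /fubini_F.
have mphix : measurable_fun setT (fun y => phi (x, y)) by exact: measurable_fun_pair2.
pose h (w : mR * T) := (2 ^+ n)%:E * (phi (x, w.1) * same_cell n (S w.2 x) w.1).
have h0 w : 0 <= h w by rewrite /h !mule_ge0// same_cell_ge0.
have mh : measurable_fun setT h.
  apply: measurable_funeM; apply: emeasurable_funM.
    exact: (measurableT_comp mphix measurable_fst).
  apply: measurable_same_cell => //.
  exact: (measurableT_comp (measurable_section x) measurable_snd).
transitivity (\int[leb]_y \int[P]_t h (y, t)).
  apply: eq_integral => y _; rewrite /slice /h /= -ge0_integralZl//; last 2 first.
  - exact: measurable_cell_section.
  - by move=> t _; exact: same_cell_ge0.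
  rewrite -ge0_integralZl//; last 2 first.
  - by apply: measurable_funeM; exact: measurable_cell_section.
  - by move=> t _; rewrite mule_ge0// same_cell_ge0.
  by apply: eq_integral => t _; rewrite muleCA.
rewrite (@fubini_tonelli _ _ _ _ _ leb P h)//.
apply: eq_integral => t _.
transitivity (\int[leb]_y ((2 ^+ n)%:E * phi (x, S t x) * same_cell n (S t x) y)).
  apply: eq_integral => y _; rewrite /h /= -muleA; congr (_ * _).
  rewrite same_cellE; have [e|_] := eqVneq; last by rewrite !mule0.
  by rewrite (inv x y (S t x)).
rewrite ge0_integralZl//; last 3 first.
- by apply: measurable_same_cell.
- by move=> y _; exact: same_cell_ge0.
- by rewrite mule_ge0.
rewrite integral_same_cell muleAC -EFinM mulfV ?mul1e//.
Qed.

(** The martingale orthogonality relation: both sides are the mean of [slice n] over the graph. *)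
Lemma integral_slice_mul n k : (n <= k)%N ->
  \int[nu]_z (slice n z * slice k z) = \int[nu]_z (slice n z * slice n z).
Proof.
move=> nk; rewrite !integral_slice//; do ?[exact: measurable_slice|exact: slice_ge0|].
- exact: slice_grid_invariant.
- by apply: (grid_invariantS nk); exact: slice_grid_invariant.
Qed.

Variable C : R.
Hypothesis energy_bound : forall r : R, (0 <= r)%R ->
  \int[m]_x \int[P]_t \int[P]_s close_indic r (S t x - S s x)%R <= (C * r)%:E.

Let K r (w : X * T * T) := close_indic r (S w.1.2 w.1.1 - S w.2 w.1.1)%R.

Let measurable_K r : measurable_fun setT (K r).
Proof.
apply: (measurableT_comp (measurable_close r)); apply: measurable_funB.
- apply: (measurableT_comp mS (_ : measurable_fun setT (fun w : X * T * T => (w.1.2, w.1.1)))).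
  by apply: measurable_fun_pair;
    [exact: (measurableT_comp measurable_snd measurable_fst)
    |exact: (measurableT_comp measurable_fst measurable_fst)].
- apply: (measurableT_comp mS (_ : measurable_fun setT (fun w : X * T * T => (w.2, w.1.1)))).
  by apply: measurable_fun_pair;
    [exact: measurable_snd|exact: (measurableT_comp measurable_fst measurable_fst)].
Qed.

Let K1 r (z : X * T) := \int[P]_s K r (z, s).

Let K1_ge0 r z : 0 <= K1 r z.
Proof. by apply: integral_ge0 => s _; exact: close_ge0. Qed.

Let measurable_K1 r : measurable_fun setT (K1 r).
Proof.
apply: (@measurable_fun_fubini_tonelli_F _ _ _ _ _ P _ (measurable_K r)).
by move=> w; exact: close_ge0.
Qed.

(** The squared norm is the graph mean of [slice n], that is, [2 ^+ n] times the probability that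
    two independent heights share a cell. They are then within [2 ^- n] of each other, and the
    energy bound at this radius absorbs the factor. *)
Lemma integral_slice_sqr_le n : \int[nu]_z (slice n z * slice n z) <= C%:E.
Proof.
have ms := measurable_slice n.
rewrite integral_slice//; do ?[exact: slice_ge0|exact: slice_grid_invariant].
have p0 : (0 < 2 ^+ n :> R)%R by rewrite exprn_gt0.
have q0 : (0 <= 2 ^- n :> R)%R by rewrite invr_ge0 ltW.
have h : (2 ^+ n)%:E * \int[m]_x \int[P]_t K1 (2 ^- n)%R (x, t) <=
    (2 ^+ n)%:E * (C * 2 ^- n)%:E.
  by apply: lee_wpmul2l => //; exact: energy_bound.
apply: (@le_trans _ _ ((2 ^+ n)%:E * (C * 2 ^- n)%:E)); last first.
  by rewrite -EFinM mulrCA mulfV ?mulr1// gt_eqF.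
apply: le_trans h; rewrite /graph_mean.
have mK2 : measurable_fun setT (fun x => \int[P]_t K1 (2 ^- n)%R (x, t)).
  exact: (@measurable_fun_fubini_tonelli_F _ _ _ _ _ P _ (measurable_K1 _)).
have mslice2 : measurable_fun setT (fun z : X * T => slice n (z.1, S z.2 z.1)).
  apply: (measurableT_comp ms); apply: measurable_fun_pair => //.
  apply: (measurableT_comp mS (_ : measurable_fun setT (fun z : X * T => (z.2, z.1)))).
  exact: measurable_fun_pair.
have K2_ge0 x : 0 <= \int[P]_t K1 (2 ^- n)%R (x, t).
  by apply: integral_ge0 => t _; exact: K1_ge0.
rewrite -(ge0_integralZl _ _ mK2)//.
apply: ge0_le_integral => //.
- by move=> x _; apply: integral_ge0 => t _; exact: slice_ge0.
- apply: (@measurable_fun_fubini_tonelli_F _ _ _ _ _ P _ mslice2).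
  by move=> w; exact: slice_ge0.
- exact: measurable_funeM.
have mK1x x : measurable_fun setT (fun t => K1 (2 ^- n)%R (x, t)).
  exact: (measurable_fun_pair2 x (measurable_K1 _)).
move=> x _; rewrite -(ge0_integralZl _ _ (mK1x x))//.
apply: ge0_le_integral => //.
- by move=> t _; exact: slice_ge0.
- exact: (measurable_fun_pair2 x mslice2).
- exact: measurable_funeM.
move=> t _; rewrite /slice /K1 /=; apply: lee_wpmul2l => //.
apply: ge0_le_integral => //.
- by move=> s _; exact: same_cell_ge0.
- exact: measurable_cell_section.
- exact: (measurable_fun_pair2 (x, t) (measurable_K _)).
move=> s _; rewrite same_cellE eq_sym -same_cellE.
exact: same_cell_le_close.
Qed.

End slices.

(** * Limits of L2-bounded martingales *)

Section L2_limit.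
Local Open Scope ereal_scope.
Context d (Z : measurableType d) (R : realType).
Variables (nu : {measure set Z -> \bar R}) (f : nat -> Z -> R) (C : R).
Hypothesis mf : forall n, measurable_fun setT (f n).
Hypothesis f0 : forall n z, (0 <= f n z)%R.
Hypothesis f2C : forall n, \int[nu]_z (f n z ^+ 2)%:E <= C%:E.
Hypothesis fM : forall n k, (n <= k)%N ->
  \int[nu]_z (f n z * f k z)%:E = \int[nu]_z (f n z ^+ 2)%:E.

Let a n : R := fine (\int[nu]_z (f n z ^+ 2)%:E).

Let f2_ge0 n : 0 <= \int[nu]_z (f n z ^+ 2)%:E.
Proof. by apply: integral_ge0 => z _; rewrite lee_fin sqr_ge0. Qed.

Let aE n : \int[nu]_z (f n z ^+ 2)%:E = (a n)%:E.
Proof.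
by rewrite /a fineK// ge0_fin_numE// (le_lt_trans (f2C n))// ltry.
Qed.

Let aC n : (a n <= C)%R. Proof. by rewrite -lee_fin -aE. Qed.

Let mfB2 n k : measurable_fun setT (fun z => ((f k z - f n z) ^+ 2)%:E).
Proof. by apply/measurable_EFinP; apply: measurable_funX; apply: measurable_funB. Qed.

(** Pythagoras. The cross terms are added on both sides, so that only nonnegative extended reals are
    integrated and no subtraction occurs before everything is known to be finite. *)
Let integral_sqrB n k : (n <= k)%N ->
  \int[nu]_z ((f k z - f n z) ^+ 2)%:E = (a k - a n)%:E.
Proof.
move=> nk; have mfk j : measurable_fun setT (fun z => (f j z ^+ 2)%:E).
  by apply/measurable_EFinP; apply: measurable_funX.
have mM : measurable_fun setT (fun z => (f n z * f k z)%:E).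
  by apply/measurable_EFinP; apply: measurable_funM.
have M0 z : 0 <= (f n z * f k z)%:E by rewrite lee_fin mulr_ge0.
have B0 z : 0 <= ((f k z - f n z) ^+ 2)%:E by rewrite lee_fin sqr_ge0.
have : \int[nu]_z (((f k z - f n z) ^+ 2)%:E + ((f n z * f k z)%:E + (f n z * f k z)%:E)) =
       \int[nu]_z ((f k z ^+ 2)%:E + (f n z ^+ 2)%:E).
  by apply: eq_integral => z _; rewrite -!EFinD; congr EFin; ring.
rewrite ge0_integralD//; last 2 first.
- by move=> z _; rewrite adde_ge0.
- exact: emeasurable_funD.
rewrite ge0_integralD// ge0_integralD//; last 2 first.
- by move=> z _; rewrite lee_fin sqr_ge0.
- by move=> z _; rewrite lee_fin sqr_ge0.
rewrite fM// !aE; case: (\int[nu]_z _) => [x| |]//= [] h.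
by congr EFin; lra.
Qed.

Let a_nd : nondecreasing_seq a.
Proof.
move=> n k nk; rewrite -subr_ge0 -lee_fin -integral_sqrB//.
by apply: integral_ge0 => z _; rewrite lee_fin sqr_ge0.
Qed.

Let a_cauchy (e : R) : (0 < e)%R -> exists N, forall k, (N <= k)%N -> (a k - a N <= e)%R.
Proof.
move=> e0; have ub : has_ubound (range a) by exists C => _ [n _ <-].
have ha := nondecreasing_is_cvgn a_nd ub.
have /cvgr_dist_lt /(_ _ e0) [N _ hN] := ha.
exists N => k Nk; have := hN N (leqnn N); rewrite /=.
have := nondecreasing_cvgn_le a_nd ha k; have := nondecreasing_cvgn_le a_nd ha N.
by move=> h1 h2; rewrite ger0_norm ?subr_ge0//; lra.
Qed.

(** Chosen so that [2 ^+ i * tol i] is the summable [1 / 2 ^+ i.+1]. *)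
Let tol i : R := ((2 ^+ i) * (2 ^+ i.+1))^-1.

Let tol_gt0 i : (0 < tol i)%R.
Proof. by rewrite /tol invr_gt0 mulr_gt0// exprn_gt0. Qed.

Let N i : nat := projT1 (cid (a_cauchy (tol_gt0 i))).

Let NP i k : (N i <= k)%N -> (a k - a (N i) <= tol i)%R.
Proof. by rewrite /N; case: cid => /= n; exact. Qed.

(** The partial sums make the subsequence nondecreasing and at least [N i]; the summand [i] makes it
    tend to infinity. *)
Let idx i : nat := (i + \sum_(j < i.+1) N j)%N.

Let idxS i : (idx i <= idx i.+1)%N.
Proof. by rewrite /idx [in leqRHS]big_ord_recr/= addSn addnA leqW// leq_addr. Qed.

Let idx_ge i : (i <= idx i)%N. Proof. by rewrite leq_addr. Qed.

Let idxN i : (N i <= idx i)%N.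
Proof. by rewrite /idx big_ord_recr/= addnA leq_addl. Qed.

Let g i := f (idx i).

Let mg i : measurable_fun setT (g i). Proof. exact: mf. Qed.

Let g0 i z : (0 <= g i z)%R. Proof. exact: f0. Qed.

Let h i z : R := 2 ^+ i * (g i.+1 z - g i z) ^+ 2.

Let h0 i z : (0 <= h i z)%R.
Proof. by apply: mulr_ge0; [exact: exprn_ge0|exact: sqr_ge0]. Qed.

Let mh i : measurable_fun setT (fun z => (h i z)%:E).
Proof.
apply/measurable_EFinP; apply: measurable_funM => //.
by apply: measurable_funX; apply: measurable_funB.
Qed.

(** This weighted sum of squared increments is integrable. Where it is finite it forces the
    subsequence to converge, and it also supplies the dominating function. *)
Let H z := \sum_(i <oo) (h i z)%:E.

Let H_ge0 z : 0 <= H z.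
Proof. by apply: nneseries_ge0 => i _ _; rewrite lee_fin. Qed.

Let mH : measurable_fun setT H.
Proof. by apply: ge0_emeasurable_sum => // i z _ _; rewrite lee_fin. Qed.

Let int_h i : \int[nu]_z (h i z)%:E <= (1 / (2 ^ i.+1)%:R)%:E.
Proof.
have p0 j : (0 < 2 ^+ j :> R)%R by rewrite exprn_gt0.
rewrite (_ : \int[nu]_z (h i z)%:E = (2 ^+ i)%:E * (a (idx i.+1) - a (idx i))%:E); last first.
  rewrite -integral_sqrB// -ge0_integralZl//; last first.
    by move=> z _; rewrite lee_fin sqr_ge0.
rewrite -EFinM lee_fin natrX div1r -ler_pdivlMl//.
apply: (@le_trans _ _ (tol i)); last by rewrite /tol invfM mulrC.
have := NP (leq_trans (idxN i) (idxS i)); have := a_nd (idxN i); lra.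
Qed.

Let int_H : \int[nu]_z H z <= 1.
Proof.
rewrite integral_nneseries//; last by move=> i z _; rewrite lee_fin.
apply: le_trans (epsilon_trick0 xpredT (ler01 : (0 <= 1 :> R)%R)).
apply: lee_nneseries => [i _ _|i _]; last exact: int_h.
by apply: integral_ge0 => z _; rewrite lee_fin.
Qed.

Let integrable_H : nu.-integrable setT H.
Proof.
apply/integrableP; split => //.
under eq_integral do rewrite gee0_abs//.
by apply: le_lt_trans int_H _; rewrite ltry.
Qed.

Let ae_H : {ae nu, forall z, H z \is a fin_num}.
Proof. by have := integrable_ae measurableT integrable_H; apply: filterS => z; exact. Qed.

Let sum_gap z k : H z \is a fin_num ->
  (\sum_(i < k) `|g i.+1 z - g i z| <= fine (H z) + 1)%R.
Proof.
move=> Hz; have sH : (\sum_(i < k) h i z <= fine (H z))%R.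
  rewrite -lee_fin fineK// -sumEFin -(big_mkord xpredT (fun i => (h i z)%:E)).
  by apply: nneseries_lim_ge => i _ _; rewrite lee_fin.
have s1 : (\sum_(i < k) (1 / (2 ^ i.+1)%:R) <= 1 :> R)%R.
  rewrite -lee_fin -sumEFin -(big_mkord xpredT (fun i => (1 / (2 ^ i.+1)%:R)%:E)).
  apply: le_trans (epsilon_trick0 xpredT (ler01 : (0 <= 1 :> R)%R)).
  by apply: nneseries_lim_ge => i _ _; rewrite lee_fin divr_ge0.
apply: le_trans (lerD sH s1); rewrite -big_split /=.
apply: ler_sum => i _; rewrite /h.
have p0 j : (0 < 2 ^+ j :> R)%R by rewrite exprn_gt0.
set t := `|_|%R; have -> : ((g i.+1 z - g i z) ^+ 2 = t ^+ 2)%R.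
  by rewrite /t real_normK ?num_real.
rewrite natrX [(2 ^+ i.+1)%R]exprS; have := p0 i; move: (2 ^+ i)%R => p pp.
have t0 : (0 <= t)%R by rewrite /t.
rewrite -(ler_pM2l pp) mulrDr (_ : p * (1 / (2 * p)) = 2^-1)%R; last first.
  by field; rewrite gt_eqF.
(* AM-GM: [t <= p t^2 + 1 / (4 p)] *)
have := sqr_ge0 (p * t - 1 / 2)%R; rewrite expr2.
have := mulr_ge0 (ltW pp) t0; nra.
Qed.

Let g_bound z k : H z \is a fin_num -> (`|g k z| <= g 0%N z + (fine (H z) + 1))%R.
Proof.
move=> Hz; have -> : (g k z = g 0%N z + \sum_(i < k) (g i.+1 z - g i z))%R.
  elim: k => [|k IH]; first by rewrite big_ord0 addr0.
  by rewrite big_ord_recr /= addrA -IH; ring.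
apply: le_trans (ler_normD _ _) _; rewrite (ger0_norm (f0 _ _)) lerD2l.
by apply: le_trans (ler_norm_sum _ _ _) _; exact: sum_gap.
Qed.

Let g_cvg z : H z \is a fin_num -> cvgn (g ^~ z).
Proof.
move=> Hz; have gE k : (g k z = g 0%N z + series (fun i => g i.+1 z - g i z) k)%R.
  elim: k => [|k IH]; first by rewrite seriesEnat /= big_geq// addr0.
  by rewrite seriesSr addrA -IH; ring.
have -> : g ^~ z = (fun k => g 0%N z + series (fun i => g i.+1 z - g i z) k)%R by apply/funext.
apply: is_cvgD; first exact: is_cvg_cst.
apply: normed_cvg.
rewrite (_ : [normed series _] = fun k => \sum_(i < k) `|g i.+1 z - g i z|)%R; last first.
  by apply/funext => k; rewrite /normed_series_of seriesEnat /= big_mkord.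
apply: nondecreasing_is_cvgn.
  by apply/nondecreasing_seqP => k; rewrite big_ord_recr/= lerDl.
by exists (fine (H z) + 1)%R => _ [k _ <-]; exact: sum_gap.
Qed.

(** The upper limit is measurable without discussing convergence, and it is the true limit wherever
    [H] is finite. *)
Definition L2_lim z : R := fine (limn_esup (fun k => (g k z)%:E)).

Let L2_limE z : H z \is a fin_num -> g ^~ z @ \oo --> L2_lim z.
Proof.
move=> Hz; have c := g_cvg Hz.
have cE : (fun k => (g k z)%:E) @ \oo --> (limn (g ^~ z))%:E.
  exact: cvg_EFin (nearW _ _) c.
rewrite /L2_lim is_cvg_limn_esupE; last exact: cvgP cE.
by rewrite (cvg_lim _ cE).
Qed.

Lemma measurable_L2_lim : measurable_fun setT L2_lim.
Proof.
apply: (measurableT_comp (fine_measurable measurableT)).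
apply: measurable_fun_limn_esup => k; exact/measurable_EFinP.
Qed.

Lemma L2_lim_ge0 z : (0 <= L2_lim z)%R.
Proof.
apply: fine_ge0; rewrite limn_esup_lim; apply: lime_ge; first exact: is_cvg_esups.
apply: nearW => n; apply: (@le_trans _ _ (g n z)%:E); first by rewrite lee_fin.
by apply: ereal_sup_ubound; exists n => /=.
Qed.

(** Fatou along the subsequence. *)
Lemma L2_lim_sqr_le : \int[nu]_z (L2_lim z ^+ 2)%:E <= C%:E.
Proof.
have mg2 k : measurable_fun setT (fun z => (g k z ^+ 2)%:E).
  by apply/measurable_EFinP; apply: measurable_funX.
have g20 k z : 0 <= (g k z ^+ 2)%:E by rewrite lee_fin sqr_ge0.
apply: (@le_trans _ _ (\int[nu]_z limn_einf (fun k => (g k z ^+ 2)%:E))).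
  apply: ae_ge0_le_integral => //.
  - by move=> z _; rewrite lee_fin sqr_ge0.
  - by apply/measurable_EFinP; apply: measurable_funX; exact: measurable_L2_lim.
  - move=> z _; rewrite limn_einf_lim; apply: lime_ge; first exact: is_cvg_einfs.
    by apply: nearW => n; apply: le_ereal_inf_tmp => _ [k _ <-].
  - apply: measurableT_comp => //; apply: measurable_fun_limn_esup => k.
    exact: measurableT_comp.
  - apply: filterS ae_H => z Hz _.
    have c : (fun k => (g k z ^+ 2)%:E) @ \oo --> (L2_lim z ^+ 2)%:E.
      apply: cvg_EFin; first exact: nearW.
      by have := L2_limE Hz => c; rewrite expr2; apply: cvgM.
    by rewrite is_cvg_limn_einfE ?(cvg_lim _ c)//; exact: cvgP c.
apply: le_trans (fatou nu measurableT mg2 (fun k z _ => g20 k z)) _.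
rewrite limn_einf_lim; apply: lime_le; first exact: is_cvg_einfs.
apply: nearW => n; apply: (@le_trans _ _ (\int[nu]_z (g n z ^+ 2)%:E)); last exact: f2C.
by apply: ereal_inf_lbound; exists n => /=.
Qed.

(** Dominated convergence on a set of finite measure, where the square-integrable [g 0] is
    integrable; the integrals along the subsequence are eventually constant. *)
Lemma L2_lim_integral (D : set Z) (c : \bar R) : measurable D -> nu D < +oo ->
  (exists n, forall k, (n <= k)%N -> \int[nu]_(z in D) (f k z)%:E = c) ->
  \int[nu]_(z in D) (L2_lim z)%:E = c.
Proof.
move=> mD Doo [n hn].
pose dom z := (g 0%N z)%:E + (H z + 1).
have intD1 : nu.-integrable D (cst 1).
  by apply/integrableP; split => //; rewrite integral_cst//= normr1 mul1e.
have intg0 : nu.-integrable D (fun z => (g 0%N z)%:E).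
  apply/integrableP; split; first by apply/measurable_EFinP; exact: measurable_funTS.
  apply: (@le_lt_trans _ _ (\int[nu]_(z in D) (1 + (g 0%N z ^+ 2)%:E))).
    apply: ge0_le_integral => //.
    - by apply: measurableT_comp => //; apply/measurable_EFinP; exact: measurable_funTS.
    - apply: emeasurable_funD => //; apply/measurable_EFinP.
      by apply: measurable_funX; exact: measurable_funTS.
    move=> z _; rewrite abse_EFin ger0_norm// -EFinD lee_fin.
    have := sqr_ge0 (g 0%N z - 1)%R; have := g0 0%N z; rewrite !expr2; nra.
  rewrite ge0_integralD//; last 2 first.
  - by move=> z _; rewrite lee_fin sqr_ge0.
  - by apply/measurable_EFinP; apply: measurable_funX; exact: measurable_funTS.
  rewrite integral_cst// mul1e lte_add_pinfty//.
  apply: (@le_lt_trans _ _ C%:E); last exact: ltry.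
  apply: le_trans (f2C (idx 0)); apply: ge0_subset_integral => //.
  - by apply/measurable_EFinP; apply: measurable_funX.
  - by move=> z _; rewrite lee_fin sqr_ge0.
have idom : nu.-integrable D dom.
  apply: integrableD => //; apply: integrableD => //.
  exact: integrableS integrable_H.
have cv : (fun k => \int[nu]_(z in D) (g k z)%:E) @ \oo --> \int[nu]_(z in D) (L2_lim z)%:E.
  have [|||||_ _] := @dominated_convergence _ _ _ nu D mD (fun k z => (g k z)%:E)
      (fun z => (L2_lim z)%:E) dom; last exact.
  - by move=> k; apply/measurable_EFinP; exact: measurable_funTS.
  - by apply/measurable_EFinP; apply: measurable_funTS; exact: measurable_L2_lim.
  - apply: filterS ae_H => z Hz _; apply: cvg_EFin; first exact: nearW.
    exact: L2_limE.
  - exact: idom.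
  - apply: filterS ae_H => z Hz k _.
    by rewrite abse_EFin /dom -(fineK Hz) -!EFinD lee_fin; exact: g_bound.
have cc : (fun k => \int[nu]_(z in D) (g k z)%:E) @ \oo --> c.
  apply: cvg_near_cst; exists n => // k /= nk; apply: hn.
  exact: leq_trans nk (idx_ge k).
exact: (cvg_unique _ cv cc).
Qed.

End L2_limit.

(** * Identification of the density *)

Section measure_unique_rays.
Context d (X : measurableType d) (R : realType).
Local Notation mR := (measurableTypeR R).

Let rays : set (set (X * mR)) :=
  [set D | exists A, measurable A /\ exists a : R, D = A `*` `]-oo, a[%classic].

Let ray_cover : \bigcup_(n : nat) `]-oo, (n%:R : R)[%classic = [set: R].
Proof.
apply/seteqP; split => // y _; exists (Num.truncn y).+1 => //=.
by rewrite in_itv /= truncnS_gt.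
Qed.

Let measurable_rays D : rays D -> measurable D.
Proof.
by move=> [A [mA [a ->]]]; apply: measurableX => //; exact: measurable_itv.
Qed.

(** A good-sets argument: for a class of sets [I] closed under complements and countable unions, all
    products [A] times [I] lie in the generated sigma-algebra. Complements are taken inside the
    slabs over [A]. *)
Let rays_generate : @measurable _ (X * mR)%type = <<s rays>>.
Proof.
apply/seteqP; split; last first.
  by apply: smallest_sub => [|D /measurable_rays//]; exact: sigma_algebra_measurable.
pose GT := g_sigma_algebraType rays.
have slab A : measurable A -> <<s rays>> (A `*` [set: mR]).
  move=> mA; rewrite -ray_cover setX_bigcupr.
  apply: (@bigcupT_measurable _ GT) => n; apply: sub_sigma_algebra.
  by exists A; split => //; exists n%:R.
pose B : set (set mR) := [set I | forall A, measurable A -> <<s rays>> (A `*` I)].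
have sB : sigma_algebra [set: mR] B.
  split.
  - by move=> A mA; rewrite setX0; exact: (@measurable0 _ GT).
  - move=> I BI A mA; rewrite setTD (_ : A `*` ~` I = (A `*` setT) `\` (A `*` I)).
      by apply: (@measurableD _ GT); [exact: slab|exact: BI].
    by apply/seteqP; split => -[x y] /=; tauto.
  - move=> F BF A mA; rewrite setX_bigcupr.
    by apply: (@bigcupT_measurable _ GT) => n; exact: BF.
have mB I : measurable I -> B I.
  move=> mI; have : (@RGenInftyO.G R).-sigma.-measurable I.
    by rewrite -RGenInftyO.measurableE.
  apply: (smallest_sub sB) => _ [a ->] A mA.
  by apply: sub_sigma_algebra; exists A; split => //; exists a.
rewrite measurable_prod_measurableType; apply: smallest_sub.
  exact: smallest_sigma_algebra.
by move=> _ [A mA [I mI <-]]; exact: mB.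
Qed.

Lemma measure_unique_rays (m1 m2 : {measure set (X * mR) -> \bar R}) :
  (m1 setT < +oo)%E ->
  (forall A (a : R), measurable A ->
    m1 (A `*` `]-oo, a[%classic) = m2 (A `*` `]-oo, a[%classic)) ->
  forall D, measurable D -> m1 D = m2 D.
Proof.
move=> fin1 m12 D mD.
apply: (measure_unique rays (fun n => setT `*` `]-oo, (n%:R : R)[%classic)) => //.
- move=> _ _ [A [mA [a ->]]] [A' [mA' [a' ->]]].
  exists (A `&` A'); split; first exact: measurableI.
  exists (Num.min a a'); rewrite -setXI; congr (_ `*` _).
  by apply/seteqP; split => y /=; rewrite !in_itv /= lt_min => /andP.
- by move=> n; exists setT; split => //; exists n%:R.
- by rewrite -setX_bigcupr ray_cover setXTT.
- by move=> _ [A [mA [a ->]]]; exact: m12.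
- move=> n; apply: le_lt_trans fin1; apply: le_measure; rewrite ?inE//.
  by apply: measurableX => //; exact: measurable_itv.
Qed.

End measure_unique_rays.

Section density_measure.
Local Open Scope ereal_scope.
Context d (Z : measurableType d) (R : realType).
Variables (nu : {measure set Z -> \bar R}) (f : Z -> R).
Hypotheses (mf : measurable_fun setT f) (f0 : forall z, (0 <= f z)%R).

Definition density_measure (A : set Z) : \bar R := \int[nu]_(z in A) (f z)%:E.

Let density0 : density_measure set0 = 0.
Proof. by rewrite /density_measure integral_set0. Qed.

Let density_ge0 A : 0 <= density_measure A.
Proof. by apply: integral_ge0 => z _; rewrite lee_fin. Qed.

Let density_sigma_additive : semi_sigma_additive density_measure.
Proof.
move=> F mF tF mUF; rewrite /density_measure ge0_integral_bigcup//.
- by apply: is_cvg_nneseries => n _ _; exact: density_ge0.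
- by apply/measurable_EFinP; exact: measurable_funTS.
- by move=> z _; rewrite lee_fin.
Qed.

Definition density_measure_pack : {measure set Z -> \bar R} :=
  HB.pack density_measure
    (isMeasure.Build _ _ _ density_measure density0 density_ge0 density_sigma_additive).

End density_measure.

(** * Exhaustion of rays by dyadic intervals *)

Section dyadic_intervals.
Context {R : realType}.
Local Notation mR := (measurableTypeR R).
Implicit Types (y : R) (k : int).

Lemma le_grid n k y : (k%:~R / 2 ^+ n <= y) = (k <= grid n y).
Proof. by rewrite /grid floor_ge_int ler_pdivrMr// mulrC. Qed.

Lemma grid_lt n k y : (grid n y < k) = (y < k%:~R / 2 ^+ n).
Proof. by rewrite /grid floor_lt_int ltr_pdivlMr// mulrC. Qed.

(** Bounded intervals with grid endpoints that increase to the ray. The lower end carries the factor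
    [2 ^+ 0] to match [le_grid] at level 0. *)
Definition ray_part (a : R) n : set mR :=
  `[(- n%:Z)%:~R / 2 ^+ 0, (grid n a)%:~R / 2 ^+ n[%classic.

Lemma measurable_ray_part a n : measurable (ray_part a n).
Proof. exact: measurable_itv. Qed.

Lemma ray_partE a n y : ray_part a n y <-> (- n%:Z <= grid 0 y) /\ (grid n y < grid n a).
Proof.
rewrite /ray_part /= in_itv /= le_grid -grid_lt.
by split=> [/andP[]//|[-> ->]].
Qed.

Lemma ray_part_invariant a n j y s : (n <= j)%N -> grid j y = grid j s ->
  ray_part a n y -> ray_part a n s.
Proof.
move=> nk ys /ray_partE[h1 h2]; apply/ray_partE.
by rewrite -(grid_coarser nk ys) -(grid_coarser (leq0n j) ys).
Qed.

Lemma ray_part_fin a n : (@lebesgue_measure R (ray_part a n) < +oo)%E.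
Proof.
rewrite /ray_part lebesgue_measure_itv /=; case: ifPn => _; last exact: ltry.
by rewrite -EFinB ltry.
Qed.

Lemma ray_part_nd a : nondecreasing_seq (ray_part a).
Proof.
apply/nondecreasing_seqP => n; rewrite subsetEset => y /ray_partE[h1 h2]; apply/ray_partE.
split; first by apply: le_trans h1; lia.
have h3 : y < (grid n a)%:~R / 2 ^+ n by rewrite -grid_lt.
rewrite grid_lt; apply: (lt_le_trans h3).
have h4 : (grid n a)%:~R / 2 ^+ n <= a by rewrite le_grid.
(* The level-[n] endpoint is also a level-[n.+1] grid point not exceeding [a], hence at most the
   next endpoint. *)
have h5 : (grid n a * 2)%:~R / 2 ^+ n.+1 = (grid n a)%:~R / 2 ^+ n :> R.
  by rewrite intrM exprS invfM; field; rewrite gt_eqF.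
by rewrite -h5 ler_pM2r ?invr_gt0// ler_int -le_grid h5.
Qed.

Lemma ray_part_bigcup a : \bigcup_n ray_part a n = `]-oo, a[%classic.
Proof.
apply/seteqP; split => y.
  move=> [n _ /ray_partE[_]]; rewrite grid_lt => h.
  by rewrite /= in_itv /=; apply: (lt_le_trans h); rewrite le_grid.
rewrite /= in_itv /= => ya.
(* The first summand puts [y] above the lower end; the second gives [2 ^+ n * (a - y) >= 1], so that
   [y] and [a] lie in different cells. *)
pose n := (`|grid 0 y| + (Num.truncn (a - y)^-1).+1)%N.
exists n => //; apply/ray_partE; split; first by rewrite /n; lia.
have ay : 0 < a - y by rewrite subr_gt0.
have h1 : 1 <= 2 ^+ n * (a - y).
  rewrite -ler_pdivrMr// div1r; apply/ltW/(lt_le_trans (truncnS_gt _)).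
  rewrite -natrX ler_nat; apply: (@leq_trans n); first by rewrite /n leq_addl.
  by rewrite ltnW// ltn_expl.
have /andP[_ h2] := floor_itv (2 ^+ n * a : R).
rewrite /grid floor_lt_int; move: h2 h1; rewrite intrD mulrBr => h2 h1.
by lra.
Qed.

End dyadic_intervals.

(** * From the energy bound to a square integrable density *)

Section L2_density.
Local Open Scope ereal_scope.
Context d1 d2 (T : measurableType d1) (X : measurableType d2) (R : realType).
Local Notation mR := (measurableTypeR R).
Local Notation leb := (@lebesgue_measure R).
Variables (P : probability T R) (m : probability X R) (S : T -> X -> mR).
Hypothesis mS : measurable_fun setT (fun z : T * X => S z.1 z.2).
Variable C : R.
Hypothesis energy_bound : forall r : R, (0 <= r)%R ->
  \int[m]_x \int[P]_t \int[P]_s close_indic r (S t x - S s x)%R <= (C * r)%:E.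
Local Notation nu := (m \x leb).
Local Notation slice := (slice P S).

Let f n z : R := fine (slice n z).

Let fE n z : slice n z = (f n z)%:E.
Proof.
rewrite /f fineK// ge0_fin_numE; last exact: slice_ge0.
by apply: le_lt_trans (slice_le _ _ _ _) _ => //; exact: ltry.
Qed.

Let mf n : measurable_fun setT (f n).
Proof.
apply: (measurableT_comp (fine_measurable measurableT)); exact: measurable_slice.
Qed.

Let f0 n z : (0 <= f n z)%R.
Proof. by rewrite -lee_fin -fE slice_ge0. Qed.

Let f2C n : \int[nu]_z (f n z ^+ 2)%:E <= C%:E.
Proof.
apply: le_trans (integral_slice_sqr_le mS energy_bound n).
rewrite le_eqVlt; apply/orP; left; apply/eqP; apply: eq_integral => z _.
by rewrite fE -EFinM expr2.
Qed.

Let fM n k : (n <= k)%N ->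
  \int[nu]_z (f n z * f k z)%:E = \int[nu]_z (f n z ^+ 2)%:E.
Proof.
move=> nk; have := integral_slice_mul P m mS nk.
rewrite (eq_integral (fun z => (f n z * f k z)%:E)); last by move=> z _; rewrite !fE -EFinM.
move=> ->; apply: eq_integral => z _; by rewrite fE -EFinM expr2.
Qed.

Let graph (w : T * X) : X * mR := (w.2, S w.1 w.2).

Let mgraph : measurable_fun setT graph.
Proof. by apply: measurable_fun_pair. Qed.

Let mu : {measure set (X * mR) -> \bar R} :=
  measure_function_pushforward__canonical__measure_function_Measure (P \x m) mgraph.

Lemma graph_mean_indic A : measurable A ->
  graph_mean P m S (fun z => (\1_A z)%:E) = (P \x m) (graph @^-1` A).
Proof.
move=> mA; have mgA : measurable (graph @^-1` A).
  by rewrite -[X in measurable X]setTI; exact: mgraph.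
transitivity (\int[P \x m]_w (\1_(graph @^-1` A) w)%:E); last first.
  by rewrite integral_indic// setIT.
pose h (w : T * X) := (\1_(graph @^-1` A) w)%:E : \bar R.
have mh : measurable_fun setT h by apply/measurable_EFinP; exact: measurable_indic.
have h0 w : 0 <= h w by rewrite lee_fin.
rewrite (@fubini_tonelli1 _ _ _ _ _ P m h mh h0) /fubini_F (@fubini_tonelli _ _ _ _ _ P m h mh h0).
apply: eq_integral => x _; apply: eq_integral => t _.
by rewrite /h !indicE.
Qed.

Theorem L2_density : exists g : X * mR -> R,
  [/\ measurable_fun setT g, forall z, (0 <= g z)%R,
      \int[nu]_z (g z ^+ 2)%:E <= C%:E &
      forall A, measurable A ->
        (P \x m) ((fun w => (w.2, S w.1 w.2)) @^-1` A) = \int[nu]_(z in A) (g z)%:E].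
Proof.
pose g := L2_lim mf f0 f2C fM.
have mg : measurable_fun setT g by exact: measurable_L2_lim.
have g0 z : (0 <= g z)%R by exact: L2_lim_ge0.
exists g; split => //; first exact: L2_lim_sqr_le.
have mu_fin : mu setT < +oo.
  rewrite /= /pushforward preimage_setT -setXTT product_measure1E//.
  by rewrite [X in X * _]probability_setT [X in _ * X]probability_setT mule1 ltry.
apply: (@measure_unique_rays _ X R mu (density_measure_pack nu mg g0) mu_fin) => A a mA.
pose D n := A `*` ray_part a n.
have mD n : measurable (D n) by apply: measurableX => //; exact: measurable_ray_part.
have mDT : measurable (\bigcup_n D n) by exact: bigcup_measurable.
have D_nd : nondecreasing_seq D.
  move=> n k nk; rewrite subsetEset => -[x y] [Ax Iy]; split => //.
  by have /subsetPset := ray_part_nd a nk; exact.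
have DT : \bigcup_n D n = A `*` `]-oo, a[%classic.
  by rewrite -setX_bigcupr ray_part_bigcup.
(* For [k >= n] the indicator of [D n] is invariant at level [k], so [slice k] already integrates
   over [D n] to the exact mass; the limit inherits this value. *)
have muD n : mu (D n) = density_measure_pack nu mg g0 (D n).
  apply/esym; apply: (L2_lim_integral mf f0 f2C fM (mD n)).
    rewrite /D [ltLHS]product_measure1E//; last exact: measurable_ray_part.
    rewrite lte_mul_pinfty ?measure_ge0//; last exact: ray_part_fin.
    by rewrite ge0_fin_numE ?measure_ge0// (le_lt_trans (probability_le1 _ _))// ltry.
  exists n => k nk.
  rewrite [RHS](_ : _ = graph_mean P m S (fun z => (\1_(D n) z)%:E)); last first.
    by rewrite graph_mean_indic.
  rewrite -(integral_slice P m mS (n := k)); last 3 first.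
  - by apply/measurable_EFinP; exact: measurable_indic.
  - by move=> z; rewrite lee_fin.
  - move=> x y s ys; rewrite !indicE; congr (EFin (nat_of_bool _)%:R).
    apply/idP/idP; rewrite !inE => -[Ax Iy]; split => //=.
      exact: ray_part_invariant nk ys Iy.
    exact: ray_part_invariant nk (esym ys) Iy.
  rewrite integral_mkcond; apply: eq_integral => z _.
  rewrite fE /patch indicE; case: ifPn => _; rewrite ?mul1e ?mul0e//.
have cmu := nondecreasing_cvg_mu (mu := mu) mD mDT D_nd.
have cden := nondecreasing_cvg_mu (mu := density_measure_pack nu mg g0) mD mDT D_nd.
have e : mu \o D = density_measure_pack nu mg g0 \o D by apply/funext => n; exact: muD.
by rewrite -DT; move: cden; rewrite -e => cden; exact: (cvg_unique _ cmu cden).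
Qed.

End L2_density.

(** * Restricted Lebesgue measures as product measures *)

Section square_and_strip.
Context {R : realType}.
Local Notation mR := (measurableTypeR R).
Local Notation leb := (@lebesgue_measure R).
Local Open Scope ereal_scope.

(** The half-open interval underlying [unif] differs from the closed one by the null point 0. *)
Lemma lebesgue_measureI01 (A : set mR) : measurable A ->
  leb (A `&` `[0%R, 1%R]%classic) = unif A.
Proof.
move=> mA; rewrite unifE -(@setU1itv _ _ _ (0%R : R) false) ?bnd_simp ?ler01// setIUr.
rewrite measureU//=; last 3 first.
- by apply: measurableI => //; exact: measurable_set1.
- by apply: measurableI => //; exact: measurable_itv.
- by apply/seteqP; split => // x [[_ ->] [_]]; rewrite /= in_itv /= ltxx.
rewrite (_ : leb (A `&` [set 0%R]) = 0) ?add0e//.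
apply: (@subset_measure0 _ _ _ leb _ [set 0%R]) => //.
- by apply: measurableI => //; exact: measurable_set1.
- exact: lebesgue_measure_set1.
Qed.

Lemma lebesgue_squareE (A : set (mR * mR)) : measurable A ->
  (unif \x unif) A = lebesgue_square R A.
Proof.
apply: product_measure_unique => B D mB mD.
transitivity ((leb \x leb) ((B `*` D) `&` (`[0%R, 1%R] `*` `[0%R, 1%R]))) => //.
rewrite -setXI product_measure1E; [|by apply: measurableI => //; exact: measurable_itv..].
by congr (_ * _); exact: lebesgue_measureI01.
Qed.

Lemma lebesgue_stripE (A : set (mR * mR)) : measurable A ->
  (unif \x leb) A = lebesgue_strip R A.
Proof.
apply: product_measure_unique => B D mB mD.
transitivity ((leb \x leb) ((B `*` D) `&` (`[0%R, 1%R] `*` setT))) => //.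
rewrite -setXI setIT product_measure1E//; last by apply: measurableI => //; exact: measurable_itv.
by congr (_ * _); exact: lebesgue_measureI01.
Qed.

Lemma Lfun2P d (Z : measurableType d) (nu : {measure set Z -> \bar R}) (g : Z -> R) :
  measurable_fun setT g -> \int[nu]_z (g z ^+ 2)%:E < +oo -> g \in Lfun nu 2%:E.
Proof.
move=> mg g2; rewrite inE; apply/andP; split; rewrite inE//= /finite_norm unlock /=.
rewrite poweR_lty// (eq_integral (fun z => (g z ^+ 2)%:E))// => z _.
by rewrite /= ?abse_EFin ?poweR_EFin powR_mulrn// real_normK ?num_real.
Qed.

End square_and_strip.

Theorem corollary6p2 (R : realType) :
  exists2 kappa0 : R, 55 / 100 <= kappa0 <= 56 / 100 &
    forall kappa : R, 1 / 2 < kappa < 1 -> kappa <= kappa0 ->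
      SBR_measure kappa `<< lebesgue_strip R /\
      exists2 f : measurableTypeR R * measurableTypeR R -> R,
        is_density (SBR_measure kappa) (lebesgue_strip R) f &
        f \in Lfun (lebesgue_strip R) 2%:E.
Proof.
exists (55 / 100); first by apply/andP; split; lra.
move=> kappa /andP[k0 k1] k55.
have k01 : 1 / 2 < kappa <= 55 / 100 by rewrite k0.
have k_lt1 : `|kappa| < 1 by rewrite gtr0_norm; lra.
(* The digit variable [xi] plays the part of [T] and the base point [x] that of [X], both
   uniform. *)
have [g [mg g0 g2 gE]] := @L2_density _ _ _ _ R unif unif (SBR_height kappa)
  (measurable_SBR_height k_lt1) _ (energy_le k01).
have dens A : measurable A ->
    SBR_measure kappa A = (\int[lebesgue_strip R]_(z in A) (g z)%:E)%E.
  move=> mA; rewrite /SBR_measure /pushforward -lebesgue_squareE; last first.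
    by rewrite -[X in measurable X]setTI; exact: measurable_SBR_map.
  rewrite [LHS](gE A mA); apply: eq_measure_integral => B mB _.
  exact: lebesgue_stripE.
split.
  move=> E nE A mA AE; rewrite dens// null_set_integral//.
  - by apply/measurable_EFinP; exact: measurable_funTS.
  - exact: nE.
exists g; first by split.
apply: Lfun2P => //.
rewrite (_ : (\int[_]_z _)%E = (\int[unif \x @lebesgue_measure R]_z (g z ^+ 2)%:E)%E).
  by apply: le_lt_trans g2 _; exact: ltry.
apply: eq_measure_integral => B mB _; exact: esym (lebesgue_stripE mB).
Qed.
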